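(* Let $\Omega$ be a domain of the square lattice $\mathbb L$ and $0<a,b\le c$. Then, under $\mathsf{Spin}_{\Omega,a,b,c}$, the triplet $(\sigma^\bullet,\xi^{\bullet+},-\xi^{\bullet-})$ satisfies the FKG inequality. The same holds also for $(\sigma^\circ,\xi^{\circ+},-\xi^{\circ-})$ and when boundary conditions of the form $\bullet+$, $\bullet-$ and/or $\circ+$, $\circ-$ are imposed. In fact, the triplet $(\sigma^\bullet,\xi^{\bullet+},-\xi^{\bullet-})$ also satisfies the FKG inequality under the measures $$\mathsf{Spin}_{\Omega,a,b,c}(\,\cdot\mid\{\sigma^\bullet|_A=\tau\})\quad\text{and}\quad\mathsf{Spin}^{\circ+}_{\Omega,a,b,c}(\,\cdot\mid\{\sigma^\bullet|_A=\tau\})$$ for any $A\subset V(\Omega^\bullet)$ and $\tau:A\to\{\pm1\}$.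
   Context: $\mathbb L$ is the square lattice with faces (squares) centred at $\mathbb Z^2$; a square is black if the coordinate sum of its centre is even, white otherwise. A domain is a finite subgraph $\Omega\subset\mathbb L$ consisting precisely of the vertices and edges on or inside a cycle $\partial\Omega$ of $\mathbb L$. $F(\Omega)$ is the set of squares enclosed by $\partial\Omega$; $\partial_F\Omega\subset F(\Omega)$ the set of those sharing a vertex with $\partial\Omega$; $\partial_{F^\bullet}\Omega$, $\partial_{F^\circ}\Omega$ are the black and white squares of $\partial_F\Omega$; $V_{\mathrm{int}}(\Omega)=V(\Omega)\setminus V(\partial\Omega)$. $\Omega^\bullet$ (resp. $\Omega^\circ$) is the graph on the black (resp. white) squares of $F(\Omega)$ in which two squares are neighbours iff they contain the same vertex of $V_{\mathrm{int}}(\Omega)$. For $x\in V_{\mathrm{int}}(\Omega)$, $d^\bullet_x\in E(\Omega^\bullet)$ and $d^\circ_x\in E(\Omega^\circ)$ are the black and white diagonal edges through $x$. $E_a$ (resp. $E_b$) is the set of edges of $\mathbb L^\bullet$ and $\mathbb L^\circ$ parallel to $e^{\pi i/4}$ (resp. $e^{3\pi i/4}$). For $\sigma^\bullet\in\{\pm1\}^{V(\Omega^\bullet)}$ write $\sigma^\bullet\perp d_x^\bullet$ if $\sigma^\bullet$ takes the same value at the endpoints of $d_x^\bullet$, and $\omega[\sigma^\bullet]=\{d_x^\circ:\sigma^\bullet\not\perp d_x^\bullet\}\subset E(\Omega^\circ)$; similarly for $\sigma^\circ\in\{\pm1\}^{V(\Omega^\circ)}$ with colours interchanged. The pair is consistent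 if for every $x\in V_{\mathrm{int}}(\Omega)$, $\sigma^\bullet\perp d_x^\bullet$ or $\sigma^\circ\perp d_x^\circ$. $\mathsf{Spin}_{\Omega,a,b,c}$ is the probability measure on consistent pairs proportional to $(a/c)^{|(\omega[\sigma^\bullet]\cup\omega[\sigma^\circ])\cap E_a|}(b/c)^{|(\omega[\sigma^\bullet]\cup\omega[\sigma^\circ])\cap E_b|}$. Boundary conditions $\bullet\pm$ (resp. $\circ\pm$), indicated by superscripts, mean conditioning on $\sigma^\bullet|_{\partial_{F^\bullet}\Omega}\equiv\pm$ (resp. $\sigma^\circ|_{\partial_{F^\circ}\Omega}\equiv\pm$). All measures are extended by an independent family $(U_x)_{x\in V_{\mathrm{int}}(\Omega)}$ of i.i.d. uniform $[0,1]$ variables. The bond percolations $\xi^\bullet\in\{0,1\}^{E(\Omega^\bullet)}$, $\xi^\circ\in\{0,1\}^{E(\Omega^\circ)}$ are defined, for each $x\in V_{\mathrm{int}}(\Omega)$, by: $\xi^\bullet(d_x^\bullet)=0$, $\xi^\circ(d_x^\circ)=1$ if $\sigma^\bullet\not\perp d^\bullet_x$; $\xi^\bullet(d_x^\bullet)=1$, $\xi^\circ(d_x^\circ)=0$ if $\sigma^\circ\not\perp d^\circ_x$; if both agree at $x$: $\xi^\bullet(d_x^\bullet)=\mathbf 1\{U_x\le a/c\}$, $\xi^\circ(d_x^\circ)=\mathbf 1\{U_x>1-b/c\}$ when $d_x^\bullet\in E_a$, and $\xi^\bullet(d_x^\bullet)=\mathbf 1\{U_x\le b/c\}$, $\xi^\circ(d_x^\circ)=\mathbf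 1\{U_x>1-a/c\}$ when $d_x^\bullet\in E_b$. $\xi^{\bullet\pm}$ is the set of open edges $uv$ of $\xi^\bullet$ with $\sigma^\bullet(u)=\sigma^\bullet(v)=\pm$; $\xi^{\circ\pm}$ is defined similarly. The triplet $(\sigma^\bullet,\xi^{\bullet+},-\xi^{\bullet-})$ means $(\sigma^\bullet,\mathbf 1_{\xi^{\bullet+}},-\mathbf 1_{\xi^{\bullet-}})$, a random variable in a product of subsets of $\mathbb R$ with the pointwise partial order (similarly for white). A random variable $X$ with values in a product $A=\prod_{i\in I}A_i$, $A_i\subset\mathbb R$, satisfies the FKG inequality if $\mathbb E[f(X)g(X)]\ge\mathbb E[f(X)]\,\mathbb E[g(X)]$ for all bounded increasing $f,g:A\to\mathbb R$. *)

(* Defs.v *)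
From HB Require Import structures.
From mathcomp Require Import all_boot all_order all_algebra finmap.
From mathcomp Require Import all_classical all_reals all_analysis.

Set Implicit Arguments.
Unset Strict Implicit.
Unset Printing Implicit Defensive.

Import Order.TTheory GRing.Theory Num.Theory.
Import numFieldNormedType.Exports.

Local Open Scope classical_set_scope.
Local Open Scope fset_scope.
Local Open Scope ring_scope.

(** * The square lattice

   Faces are named by their centre in Z^2.  The vertices lie in (Z + 1/2)^2;
   the vertex named [x : zpoint] is the point x + (1/2, 1/2) of the plane, i.e.
   the upper right corner of the face x. *)

Definition zpoint : Type := (int * int)%type.

Definition shift (x : zpoint) (i j : int) : zpoint := (x.1 + i, x.2 + j).

(* vertices of the face f *)
Definition corners (f : zpoint) : seq zpoint :=
  [:: f; shift f (-1) 0; shift f (-1) (-1); shift f 0 (-1)].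

Definition adjL : rel zpoint :=
  fun x y => `|x.1 - y.1| + `|x.2 - y.2| == 1.

(* Colours are booleans: true is black, false is white. *)
Definition colour (f : zpoint) : bool := (2 %| f.1 + f.2)%Z.

(* Cycles of the lattice, given by their vertices in cyclic order; the bound on
   the size excludes an edge traversed back and forth. *)
Definition lattice_cycle (c : seq zpoint) : Prop :=
  (2 < size c)%N /\ ucycle adjL c.

Definition cycle_edge (c : seq zpoint) (x y : zpoint) : bool :=
  ((x \in c) && (next c x == y)) || ((y \in c) && (next c y == x)).

(* One can step from f to g if these are distinct faces sharing an edge xy of
   the lattice that does not belong to the cycle c. *)
Definition face_step (c : seq zpoint) : rel zpoint := fun f g =>
  (f != g) &&
  has (fun x => has (fun y =>
    [&& adjL x y, x \in corners g, y \in corners g & ~~ cycle_edge c x y])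
    (corners f)) (corners f).

(* f is enclosed by c: its connected component in the complement of c is
   bounded. *)
Definition enclosed (c : seq zpoint) (f : zpoint) : Prop :=
  exists N : int, forall p : seq zpoint, path (face_step c) f p ->
    `|(last f p).1| <= N /\ `|(last f p).2| <= N.

(** * Domains *)

(* A domain is determined by its boundary cycle; the field [faces] records the
   (finite) set of enclosed faces. *)
Record domain : Type := Domain {
  bdry : seq zpoint;
  bdryP : lattice_cycle bdry;
  faces : {fset zpoint};
  facesP : forall f : zpoint, f \in faces <-> enclosed bdry f
}.

Section Graphs.
Variable Om : domain.

(* A vertex off the cycle lies inside it iff it is a corner of an enclosed
   face. *)
Definition verts : {fset zpoint} :=
  [fset x in bdry Om ++ flatten [seq corners f | f <- faces Om]].

Definition Vint : {fset zpoint} := [fset x in verts | x \notin bdry Om].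

Definition bfaces : {fset zpoint} :=
  [fset f in faces Om | has (fun x => x \in bdry Om) (corners f)].

(* An edge of the black or white lattice is given by the vertex x at its middle
   and its direction: (x, true) is parallel to exp(i pi/4), thus in E_a, and
   (x, false) is parallel to exp(3 i pi/4), thus in E_b. *)
Definition edge : Type := (zpoint * bool)%type.

Definition in_Ea (e : edge) : bool := e.2.

Definition ends (e : edge) : seq zpoint :=
  if in_Ea e then [:: e.1; shift e.1 1 1]
  else [:: shift e.1 1 0; shift e.1 0 1].

(* The graph of colour k (black for k = true, white for k = false): its
   vertices, its diagonal edge through x, and its edges. *)
Definition V (k : bool) : {fset zpoint} := [fset f in faces Om | colour f == k].

(* The four faces around x are x, x + (1,1), of the colour of x, and x + (1,0),
   x + (0,1), of the other colour. *)
Definition diag (k : bool) (x : zpoint) : edge := (x, colour x == k).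

Definition E (k : bool) : {fset edge} := [fset diag k x | x in Vint].

(** * Spins *)

(* The value true stands for +1 and false for -1. *)
Definition spin (k : bool) : Type := {ffun V k -> bool}.

Definition agree (k : bool) (s : spin k) (e : edge) : bool :=
  [forall u : V k, forall v : V k,
    (val u \in ends e) && (val v \in ends e) ==> (s u == s v)].

(* omega[s], a set of edges of the opposite colour *)
Definition omega (k : bool) (s : spin k) : {fset edge} :=
  [fset diag (~~ k) x | x in Vint & ~~ agree s (diag k x)].

Definition config : Type := (spin true * spin false)%type.

Definition proj (s : config) (k : bool) : spin k :=
  match k with true => s.1 | false => s.2 end.

Definition consistent (s : config) : bool :=
  [forall x : Vint, agree s.1 (diag true (val x)) ||
                    agree s.2 (diag false (val x))].

(* The boundary condition on the spins of colour k; None is no condition. *)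
Definition bc (k : bool) (o : option bool) (s : config) : bool :=
  if o is Some sgn
  then [forall u : V k, (val u \in bfaces) ==> (proj s k u == sgn)]
  else true.

Definition restr_eq (A : {set V true}) (tau : V true -> bool) (s : config) :
  bool := [forall u in A, s.1 u == tau u].

Section Measures.
Variables (R : realType) (a b c : R).

Definition spin_weight (s : config) : R :=
  let w := omega s.1 `|` omega s.2 in
  (a / c) ^+ #|` [fset e in w | in_Ea e]| *
  (b / c) ^+ #|` [fset e in w | ~~ in_Ea e]|.

(* Measures on spin configurations are given by their mass functions. *)
Definition Spin (s : config) : R :=
  (consistent s)%:R * spin_weight s /
  \sum_(s' : config | consistent s') spin_weight s'.

Definition cond (mu : config -> R) (C : pred config) (s : config) : R :=
  (C s)%:R * mu s / \sum_(s' : config | C s') mu s'.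

(* Spin with boundary conditions ob on the black and ow on the white spins *)
Definition Spin_bc (ob ow : option bool) : config -> R :=
  cond Spin [pred s | bc true ob s && bc false ow s].

(** * The bond percolations *)

Definition edge_par (e : edge) : R := if in_Ea e then a / c else b / c.

Definition xi_rule (k : bool) (s : config) (U : Vint -> R) (x : Vint) : bool :=
  let db := diag true (val x) in
  let dw := diag false (val x) in
  if ~~ agree s.1 db then ~~ k
  else if ~~ agree s.2 dw then k
  else if k then U x <= edge_par db
  else U x > 1 - edge_par dw.

Definition xi (k : bool) (s : config) (U : Vint -> R) : {fset edge} :=
  [fset diag k (val x) | x : Vint & xi_rule k s U x].

Definition xi_sgn (k : bool) (sgn : bool) (s : config) (U : Vint -> R) :
  {fset edge} :=
  [fset e in xi k s U |
    [forall u : V k, (val u \in ends e) ==> (proj s k u == sgn)]].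

Inductive tindex (k : bool) : Type :=
  | IV of V k
  | IEplus of E k
  | IEminus of E k.

Definition triplet (k : bool) (s : config) (U : Vint -> R) (i : tindex k) : R :=
  match i with
  | IV u => if proj s k u then 1 else -1
  | IEplus e => (val e \in xi_sgn k true s U)%:R
  | IEminus e => - (val e \in xi_sgn k false s U)%:R
  end.

Definition triplet_range (k : bool) (i : tindex k) : set R :=
  match i with
  | IV _ => [set -1; 1]
  | IEplus _ => [set 0; 1]
  | IEminus _ => [set 0; -1]
  end.

End Measures.
End Graphs.

(** * The FKG inequality *)

Section FKG.
Context (R : realType) (d : measure_display) (T : measurableType d).
Variable P : probability T R.

Definition fkg_test (I : Type) (A : I -> set R) (f : (I -> R) -> R) : Prop :=
  let PA := [set x : I -> R | forall i, A i (x i)] in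
  (exists M : R, forall x, PA x -> `|f x| <= M) /\
  (forall x y, PA x -> PA y -> (forall i, x i <= y i) -> f x <= f y).

(* The values of f and g off the product of the A i are irrelevant for X with
   values in that product.  When that product is finite, as it is for the
   triplets, all expectations below are those of simple random variables. *)
Definition satisfies_FKG (I : Type) (A : I -> set R) (X : T -> I -> R) : Prop :=
  forall f g : (I -> R) -> R, fkg_test A f -> fkg_test A g ->
    ('E_P[fun t => (f (X t))%R] * 'E_P[fun t => (g (X t))%R] <=
       'E_P[fun t => (f (X t) * g (X t))%R])%E.

(* Under P, the pair of spin configurations S has law mu, the U x are uniform
   on [0, 1], and S and the U x are independent. *)
Definition extends_law (Om : domain) (mu : config Om -> R)
    (S : T -> config Om) (U : Vint Om -> {RV P >-> R}) : Prop :=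
  (forall s, measurable (S @^-1` [set s])) /\
  (forall (s : config Om) (B : Vint Om -> set R), (forall x, measurable (B x)) ->
    P (S @^-1` [set s] `&`
         \bigcap_(x in [set: Vint Om]) (U x @^-1` B x))%classic =
      (mu s)%:E * \prod_(x : Vint Om) uniform_prob (@ltr01 R) (B x))%E.
End FKG.

(* The measure mu on spin configurations, extended by i.i.d. uniform variables,
   makes the triplet of colour k satisfy the FKG inequality.  The extension is
   unique in law, and is realised on an arbitrary probability space. *)
Definition triplet_FKG (R : realType) (a b c : R) (Om : domain)
    (mu : config Om -> R) (k : bool) : Prop :=
  forall (d : measure_display) (T : measurableType d) (P : probability T R)
    (S : T -> config Om) (U : Vint Om -> {RV P >-> R}),
  extends_law mu S U ->
  satisfies_FKG P (@triplet_range Om R k)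
    (fun t => @triplet Om R a b c k (S t) (fun x => U x t)).
Arguments triplet_FKG {R} a b c Om mu k.

(* Main.v *)
From HB Require Import structures.
From mathcomp Require Import all_boot all_order all_algebra all_fingroup finmap.
From mathcomp Require Import all_classical all_reals all_analysis.
From mathcomp Require Import zify ring lra.
Require Import Defs.

Set Implicit Arguments.
Unset Strict Implicit.
Unset Printing Implicit Defensive.

Import Order.TTheory GRing.Theory Num.Theory.

Local Open Scope ring_scope.

(** Let k be the colour of the triplet and l the other colour, and let p_x and
q_x be the weights, a/c or b/c, of the edges of colours k and l through x.
Summing out the spins of colour l and the uniform variables, a pair (t, xi) of
spins and bond percolation of colour k gets a weight which is a product over x,
namely p_x if x is open (which forces t to agree at x), 1 - p_x if x is closed
and t agrees, q_x if t disagrees, times the number N(xi) of spin configurations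
of colour l that satisfy the boundary condition and agree at every closed x
([sum_joint_weight]).

If p_x + q_x > 1, this weight violates the FKG lattice condition: for two spins,
(+,-) and (-,+) have meet and join of too small a weight with the edge closed.
The remedy is to decide on open edges before knowing where t agrees: sample two
independent Bernoulli(p) percolations z+ and z- on all edges, and keep the
edges of z+ with two plus ends and the edges of z- with two minus ends.  This
produces the same law ([sum_coupling]), with weight
  (product of q_x over disagreements) Bern(z+) Bern(z-) N(xi+) N(xi-) / N(0),
and now the lattice condition holds in (t, z+, - z-) because q_x <= 1 and
because N is increasing and log-supermodular ([coupling_weightM]).  The triplet
is an increasing function of (t, z+, - z-), so the four functions theorem of
Ahlswede and Daykin applies.  Conditioning on spins of colour k restricts t to
a sublattice; conditioning on boundary spins of colour l only changes N.

Up to a shift of the spins by a constant, N(xi) is the order of a subgroup G(xi)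
of the group of functions to F_2, where G(A) meets G(B) in G(A & B) and
G(A) + G(B) is contained in G(A | B); comparing orders gives the
log-supermodularity.  The splitting N(xi+ | xi-) N(0) = N(xi+) N(xi-) used above
is equality in that inclusion, and is where planarity enters
([card_compat_split]).  If s lies in G(xi+ | xi-), the set of x at which s
disagrees is a cut of the graph of colour l; one has to see that its part on
plus edges is again a cut.  Plus edges and minus edges have no common end, so
this part has, like the whole cut, an even number of edges at every face of
colour k off the boundary, and it is a question of exactness.  The domain has no
hole: a finite set Z of interior vertices that is even around all faces of one
colour is the gradient of a function B, obtained by summing Z along diagonals;
B is constant along the boundary cycle and vanishes at its rightmost vertex,
hence at all boundary faces ([domain_primitive]).  With a boundary condition on
colour l this applies to the part of the cut itself ([cut_split_wired]).
Without one, the part of the cut is tested against all cycles Z of the graph of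
colour l; since Z is the gradient of a function on colour k vanishing on the
boundary, summation by parts shows that the pairing is zero
([cut_split_free]). *)

(** * The four functions theorem *)

Section FourFunctions.
Variable R : realFieldType.

(** The conclusion of the Ahlswede-Daykin theorem for the operations [jn] and
[mt].  In this form it passes to products and to the reversed order, so that the
theorem is only needed on a Boolean lattice. *)
Definition four_functions (L : finType) (jn mt : L -> L -> L) : Prop :=
  forall al be ga de : L -> R,
    (forall x, 0 <= al x) -> (forall x, 0 <= be x) ->
    (forall x, 0 <= ga x) -> (forall x, 0 <= de x) ->
    (forall x y, al x * be y <= ga (jn x y) * de (mt x y)) ->
  (\sum_x al x) * (\sum_x be x) <= (\sum_x ga x) * (\sum_x de x).

Lemma four_functions_dual (L : finType) (jn mt : L -> L -> L) :
  four_functions jn mt -> four_functions mt jn.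
Proof.
move=> ffL al be ga de al0 be0 ga0 de0 H.
rewrite [leRHS]mulrC; apply: ffL => // x y; rewrite [leRHS]mulrC; exact: H.
Qed.

Lemma four_functions_prod (L1 L2 : finType) (jn1 mt1 : L1 -> L1 -> L1)
    (jn2 mt2 : L2 -> L2 -> L2) :
  four_functions jn1 mt1 -> four_functions jn2 mt2 ->
  four_functions (fun x y : L1 * L2 => (jn1 x.1 y.1, jn2 x.2 y.2))
                 (fun x y => (mt1 x.1 y.1, mt2 x.2 y.2)).
Proof.
move=> ff1 ff2 al be ga de al0 be0 ga0 de0 H.
have sumE (f : L1 * L2 -> R) : \sum_x f x = \sum_x \sum_y f (x, y).
  by rewrite pair_bigA; apply: eq_bigr => -[].
rewrite !sumE; apply: ff1 => [x|x|x|x|x y]; try by apply: sumr_ge0.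
by apply: ff2 => // u v; apply: (H (x, u) (y, v)).
Qed.

(** The case of a lattice with two elements.  With M = c1 d0, the only
nontrivial part is a0 b1 + a1 b0 <= M + c0 d1, which follows from
(M - a0 b1) (M - a1 b0) >= 0 on dividing by M. *)
Lemma four_functions_bool (a0 a1 b0 b1 c0 c1 d0 d1 : R) :
  0 <= a0 -> 0 <= a1 -> 0 <= b0 -> 0 <= b1 ->
  0 <= c0 -> 0 <= c1 -> 0 <= d0 -> 0 <= d1 ->
  a0 * b0 <= c0 * d0 -> a0 * b1 <= c1 * d0 -> a1 * b0 <= c1 * d0 ->
  a1 * b1 <= c1 * d1 -> (a0 + a1) * (b0 + b1) <= (c0 + c1) * (d0 + d1).
Proof.
move=> a00 a10 b00 b10 c00 c10 d00 d10 h00 h01 h10 h11.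
suff : a0 * b1 + a1 * b0 <= c1 * d0 + c0 * d1.
  by rewrite !mulrDl !mulrDr => h; lra.
have m01 : 0 <= a0 * b1 by apply: mulr_ge0.
have m10 : 0 <= a1 * b0 by apply: mulr_ge0.
have mc : 0 <= c0 * d1 by apply: mulr_ge0.
have [z|nz] := eqVneq (c1 * d0) 0; first by rewrite z in h01 h10 *; lra.
have p : 0 < c1 * d0 by rewrite lt0r nz mulr_ge0.
have e : (a0 * b1) * (a1 * b0) <= (c1 * d0) * (c0 * d1).
  have -> : (a0 * b1) * (a1 * b0) = (a0 * b0) * (a1 * b1) by ring.
  have -> : (c1 * d0) * (c0 * d1) = (c0 * d0) * (c1 * d1) by ring.
  by apply: ler_pM => //; apply: mulr_ge0.
rewrite -(ler_pM2l p); nra.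
Qed.

Definition ffor (T : finType) (x y : {ffun T -> bool}) := [ffun t => x t || y t].
Definition ffand (T : finType) (x y : {ffun T -> bool}) := [ffun t => x t && y t].

(** Induction on the set [s] of coordinates that may be nonzero; summing out one
coordinate preserves the hypothesis by the two-element case. *)
Lemma four_functions_ffun (T : finType) :
  four_functions (@ffor T) (@ffand T).
Proof.
move=> al be ga de al0 be0 ga0 de0 H.
pose up t (x : {ffun T -> bool}) := [ffun u => (u == t) || x u].
pose dn t (x : {ffun T -> bool}) := [ffun u => (u != t) && x u].
pose S (s : seq T) (x : {ffun T -> bool}) := [forall t, x t ==> (t \in s)].
suff main (s : seq T) : uniq s -> forall al be ga de : {ffun T -> bool} -> R,
    (forall x, 0 <= al x) -> (forall x, 0 <= be x) ->
    (forall x, 0 <= ga x) -> (forall x, 0 <= de x) ->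
    (forall x y, S s x -> S s y ->
       al x * be y <= ga (ffor x y) * de (ffand x y)) ->
    (\sum_(x | S s x) al x) * (\sum_(x | S s x) be x) <=
    (\sum_(x | S s x) ga x) * (\sum_(x | S s x) de x).
  have e (f : {ffun T -> bool} -> R) : \sum_(x | S (enum T) x) f x = \sum_x f x.
    apply: eq_bigl => x; apply/forallP => t; rewrite mem_enum.
    exact: implybT.
  by rewrite -!e; apply: main => //; apply: enum_uniq.
elim: s => [_|t s IH /= /andP[ts us]] {H}{}al {}be {}ga {}de {}al0 {}be0 {}ga0 {}de0 H.
  have S0 x : S [::] x = (x == [ffun => false]).
    apply/forallP/eqP => [h|-> u]; last by rewrite ffunE.
    by apply/ffunP => u; have := h u; rewrite ffunE implybF => /negbTE.
  rewrite !(eq_bigl _ _ S0) !big_pred1_eq.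
  have := H [ffun => false] [ffun => false]; rewrite !S0 => /(_ (eqxx _) (eqxx _)).
  congr (_ <= ga _ * de _); apply/ffunP => u; by rewrite !ffunE.
have Sx x : S s x -> x t = false.
  by move=> /forallP/(_ t); rewrite (negbTE ts) implybF => /negbTE.
have Sup x : S s x -> S (t :: s) x && S (t :: s) (up t x).
  move=> /forallP h; apply/andP; split; apply/forallP => u; rewrite ?ffunE inE.
    by apply/implyP => xu; rewrite (implyP (h u)) ?orbT.
  case: eqP => //= _; exact: h.
have split (f : {ffun T -> bool} -> R) :
    \sum_(x | S (t :: s) x) f x = \sum_(x | S s x) (f x + f (up t x)).
  rewrite (bigID (fun x : {ffun T -> bool} => ~~ x t)) big_split /=; congr (_ + _).
    apply: eq_bigl => x; apply/andP/idP => [[/forallP h xt]|h].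
      apply/forallP => u; apply/implyP => xu.
      have := implyP (h u) xu; rewrite inE; case: eqP => // eut.
      by rewrite eut (negbTE xt) in xu.
    by have /andP[-> _] := Sup _ h; rewrite (Sx _ h).
  rewrite (reindex_onto (up t) (dn t)) /=; last first.
    move=> x /andP[_]; rewrite negbK => xt; apply/ffunP => u; rewrite !ffunE.
    by case: eqP => //= ->.
  apply: eq_bigl => x; apply/idP/idP.
    move=> /andP[/andP[/forallP h _] /eqP e]; apply/forallP => u.
    apply/implyP => xu; have := h u; rewrite !ffunE inE xu orbT /=.
    case: eqP => //= eut; move: xu; rewrite -e eut !ffunE eqxx; done.
  move=> h; have /andP[_ ->] := Sup _ h; rewrite !ffunE eqxx /=.
  apply/eqP/ffunP => u; rewrite !ffunE; case: eqP => //= ->.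
  by rewrite (Sx _ h).
rewrite !split; apply: IH => // [x|x|x|x|x y Hx Hy]; try exact: addr_ge0.
have or1 : ffor (up t x) y = up t (ffor x y).
  by apply/ffunP => u; rewrite !ffunE orbA.
have or2 : ffor x (up t y) = up t (ffor x y).
  by apply/ffunP => u; rewrite !ffunE orbCA.
have or3 : ffor (up t x) (up t y) = up t (ffor x y).
  by apply/ffunP => u; rewrite !ffunE; case: eqP.
have an1 : ffand (up t x) y = ffand x y.
  by apply/ffunP => u; rewrite !ffunE; case: eqP => //= ->; rewrite !Sx.
have an2 : ffand x (up t y) = ffand x y.
  by apply/ffunP => u; rewrite !ffunE; case: eqP => //= ->; rewrite !Sx.
have an3 : ffand (up t x) (up t y) = up t (ffand x y).
  by apply/ffunP => u; rewrite !ffunE; case: eqP.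
have /andP[x0 x1] := Sup _ Hx; have /andP[y0 y1] := Sup _ Hy.
apply: four_functions_bool => //; first exact: H.
- by rewrite -or2 -an2; apply: H.
- by rewrite -or1 -an1; apply: H.
- by rewrite -or3 -an3; apply: H.
Qed.

(** Adding constants to [f] and [g] changes both sides equally, so they may be
taken nonnegative; then the four functions are mu f, mu g, mu f g and mu. *)
Lemma FKG_of_four_functions (L : finType) (jn mt : L -> L -> L) (mu f g : L -> R) :
  four_functions jn mt ->
  (forall x, 0 <= mu x) ->
  (forall x y, mu x * mu y <= mu (jn x y) * mu (mt x y)) ->
  (forall x y, f x <= f (jn x y)) -> (forall x y, g y <= g (jn x y)) ->
  (\sum_x mu x * f x) * (\sum_x mu x * g x) <=
  (\sum_x mu x) * (\sum_x mu x * (f x * g x)).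
Proof.
move=> ff mu0 mulat.
wlog : f g / (forall x, 0 <= f x) /\ (forall x, 0 <= g x).
  move=> hw fm gm.
  have bdd (h : L -> R) : exists M, forall x, 0 <= h x + M.
    exists (\sum_x `|h x|) => x; rewrite (bigD1 x) //= addrA.
    apply: addr_ge0; last by apply: sumr_ge0.
    by have := lerNnormlW (lexx `|h x|); lra.
  have [M fM] := bdd f; have [M' gM] := bdd g.
  have := hw (fun x => f x + M) (fun x => g x + M').
  rewrite /=; have -> : \sum_x mu x * (f x + M) =
      \sum_x mu x * f x + (\sum_x mu x) * M.
    by rewrite big_distrl -big_split; apply: eq_bigr => x _; rewrite mulrDr.
  have -> : \sum_x mu x * (g x + M') = \sum_x mu x * g x + (\sum_x mu x) * M'.
    by rewrite big_distrl -big_split; apply: eq_bigr => x _; rewrite mulrDr.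
  have -> : \sum_x mu x * ((f x + M) * (g x + M')) =
      \sum_x mu x * (f x * g x) + M' * (\sum_x mu x * f x) +
      M * (\sum_x mu x * g x) + M * M' * (\sum_x mu x).
    by rewrite !big_distrr -!big_split; apply: eq_bigr => x _ /=; ring.
  move=> h; have := h (conj fM gM) (fun x y => lerD (fm x y) (lexx _))
    (fun x y => lerD (gm x y) (lexx _)).
  set F := \sum_x mu x * f x; set G := \sum_x mu x * g x.
  set Z := \sum_x mu x; set H := \sum_x _; clear; move=> h.
  by lra.
move=> [f0 g0] fm gm; rewrite [leRHS]mulrC.
apply: ff => [x|x|x|x|x y]; rewrite ?mulr_ge0 //.
rewrite mulrACA [leRHS]mulrAC.
by rewrite ler_pM ?mulr_ge0 // ler_pM.
Qed.
End FourFunctions.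

(** * Primitives of closed chains in a domain *)

Lemma shiftE (p q i j : int) : shift (p, q) i j = (p + i, q + j).
Proof. by []. Qed.

Lemma shift0 x : shift x 0 0 = x.
Proof. by case: x => p q; rewrite shiftE !addr0. Qed.

Lemma shiftD x i j i' j' : shift (shift x i j) i' j' = shift x (i + i') (j + j').
Proof. by rewrite /shift /= !addrA. Qed.

Lemma colour_shift x i j : colour (shift x i j) = (colour x == (2 %| i + j)%Z).
Proof. by rewrite /colour /=; lia. Qed.

(** The ends of the edge of colour [k] through [x]. *)
Definition end1 (k : bool) (x : zpoint) := if colour x == k then x else shift x 1 0.
Definition end2 (k : bool) (x : zpoint) :=
  if colour x == k then shift x 1 1 else shift x 0 1.

Lemma ends_diag k x : ends (diag k x) = [:: end1 k x; end2 k x].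
Proof. by rewrite /ends /in_Ea /diag /end1 /end2 /=; case: eqP. Qed.

Lemma colour_end1 k x : colour (end1 k x) = k.
Proof.
rewrite /end1; case: eqP => // h; rewrite colour_shift.
by case: (colour x) k h => -[].
Qed.

Lemma colour_end2 k x : colour (end2 k x) = k.
Proof.
by rewrite /end2; case: eqP => h; rewrite colour_shift; case: (colour x) k h => -[].
Qed.

Lemma mem_ends k x f :
  colour f = k -> (f \in ends (diag k x)) = (x \in corners f).
Proof.
move=> <-; rewrite ends_diag /end1 /end2 !inE.
case: x f => p q [r s]; rewrite /colour /shift /= !xpair_eqE.
by case: (boolP ((2 %| p + q)%Z == (2 %| r + s)%Z)) => h /=; rewrite !xpair_eqE; lia.
Qed.

(** The differential mod 2 of a function on the faces of colour [k]. *)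
Definition grad (k : bool) (c : zpoint -> bool) (x : zpoint) : bool :=
  c (end1 k x) (+) c (end2 k x).

(** The sum mod 2 over the corners of a face.  It vanishes on gradients of
functions on the faces of the other colour, because the four such faces around
[f] form a cycle. *)
Definition circ (z : zpoint -> bool) (f : zpoint) : bool :=
  z f (+) z (shift f (-1) 0) (+) z (shift f (-1) (-1)) (+) z (shift f 0 (-1)).

Lemma circ_grad k c f : colour f != k -> circ (grad k c) f = false.
Proof.
move=> fk; rewrite /circ /grad /end1 /end2 !colour_shift.
have -> : (colour f == k) = false by apply/negbTE.
have -> : (2 %| (-1 + 0)%R)%Z = false by [].
have -> : (2 %| (-1 - 1)%R)%Z = true by [].
have -> : ((colour f == true) == k) = false by move: fk; case: (colour f) k => -[].
have -> : ((colour f == false) == k) = true by move: fk; case: (colour f) k => -[].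
rewrite !shiftD.
have h b1 b2 b3 b4 : b1 (+) b2 (+) (b3 (+) b2) (+) (b4 (+) b3) (+) (b4 (+) b1) = false.
  by case: b1 b2 b3 b4 => -[] [] [].
exact: (h (c (shift f 1 0)) (c (shift f 0 1)) (c (shift f (-1) 0)) (c (shift f 0 (-1)))).
Qed.

(** The primitive sums [z] along the diagonal ray in direction (1, 1), which is
finite as [z] vanishes far to the right.  By construction its gradient is right
at edges in that direction; at edges in the other direction, the error is
invariant under the shift by (1, 1), because [z] is even around the face in
between, and vanishes far to the right. *)
Lemma plane_primitive (k : bool) (z : zpoint -> bool) (X : int) :
  (forall x : zpoint, z x -> x.1 <= X) ->
  (forall f, colour f != k -> circ z f = false) ->
  exists B : zpoint -> bool,
    (forall x, grad k B x = z x) /\ (forall w : zpoint, X < w.1 -> B w = false).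
Proof.
move=> zX zc.
pose B (w : zpoint) := \big[addb/false]_(j < absz (X + 1 - w.1)%R) z (shift w j j).
have z0 (x : zpoint) : X < x.1 -> z x = false.
  by move=> h; apply/negP => /zX; rewrite leNgt h.
have B0 (w : zpoint) : X < w.1 -> B w = false.
  move=> h; rewrite /B big1 // => j _; apply: z0; move: (nat_of_ord j) => n; rewrite /shift /=; lia.
have BS (w : zpoint) : B w = z w (+) B (shift w 1 1).
  have [h|h] := ltP X w.1.
    by rewrite z0 // !B0 //; rewrite /shift /=; lia.
  have e : absz (X + 1 - w.1)%R = (absz (X + 1 - (shift w 1 1).1)%R).+1.
    by rewrite /shift /=; lia.
  rewrite {1}/B e big_ord_recl shift0; congr (_ (+) _).
  by apply: eq_bigr => j _; rewrite shiftD.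
have H (u : zpoint) : colour u = k ->
    B u (+) B (shift u 1 (-1)) = z (shift u 0 (-1)).
  move: {2}(absz (X + 1 - u.1)%R) (leqnn (absz (X + 1 - u.1)%R)) => n.
  elim: n u => [|n IH] u hn uk.
    by rewrite !B0 ?z0 //; move: hn; rewrite ?/shift /=; lia.
  have [h|h] := ltP X u.1.
    by rewrite !B0 ?z0 // ?/shift /=; lia.
  have hn1 : (absz (X + 1 - (shift u 1 1).1)%R <= n)%N by move: hn; rewrite /shift /=; lia.
  have k1 : colour (shift u 1 1) = k by rewrite colour_shift uk; case: (k).
  have k2 : colour (shift u 1 0) != k by rewrite colour_shift uk; case: (k).
  have := IH _ hn1 k1; have := zc _ k2; rewrite /circ !shiftD.
  rewrite (BS u) (BS (shift u 1 (-1))) shiftD /=.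
  have -> : shift u (1 - 1) (0 + 0) = u := shift0 u.
  have taut b1 b2 b3 b4 b5 b6 : b1 (+) b2 (+) b3 (+) b4 = false ->
      b5 (+) b6 = b1 -> b2 (+) b5 (+) (b4 (+) b6) = b3.
    by case: b1 b2 b3 b4 b5 b6 => -[] [] [] [] [].
  exact: taut.
exists B; split=> // x; rewrite /grad /end1 /end2; case: eqP => [_|xk].
  by rewrite BS; case: (z x); case: (B _).
have k1 : colour (shift x 0 1) = k.
  by rewrite colour_shift; case: (colour x) (k) xk => -[].
have := H _ k1; rewrite !shiftD.
have -> : shift x (0 + 0) (1 - 1) = x := shift0 x.
by rewrite addbC.
Qed.

Section DomainGeometry.
Variable Om : domain.
Implicit Types (x y f : zpoint).

Lemma mem_Vint x :
  x \in Vint Om <-> x \notin bdry Om /\ exists2 f : zpoint, f \in faces Om & x \in corners f.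
Proof.
rewrite /Vint /verts !(inE, mem_cat) /=; split.
  case/andP => /orP[->|] // /flattenP[s /mapP[f fO ->] xf] ->; split=> //.
  by exists f.
move=> [xb [f fO xf]]; rewrite xb andbT; apply/orP; right.
by apply/flattenP; exists (corners f) => //; apply/mapP; exists f.
Qed.

Lemma cycle_edge_mem x y :
  cycle_edge (bdry Om) x y -> (x \in bdry Om) && (y \in bdry Om).
Proof.
by case/orP => /andP[h /eqP <-]; rewrite mem_next h.
Qed.

Lemma face_stepI f g x y : f != g -> adjL x y -> x \in corners f -> y \in corners f ->
  x \in corners g -> y \in corners g -> x \notin bdry Om ->
  face_step (bdry Om) f g.
Proof.
move=> fg xy xf yf xg yg xb; rewrite /face_step fg andTb.
apply/hasP; exists x => //; apply/hasP; exists y => //.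
by rewrite xy xg yg; apply: contra xb => /cycle_edge_mem/andP[].
Qed.

Lemma enclosed_step f g :
  face_step (bdry Om) f g -> f \in faces Om -> g \in faces Om.
Proof.
move=> fg /facesP[N hN]; apply/facesP; exists N => p gp.
by apply: (hN (g :: p)); rewrite /= fg.
Qed.

(** No edge at an interior vertex belongs to the cycle, so the faces around it
can be visited one after the other. *)
Lemma Vint_face x f : x \in Vint Om -> x \in corners f -> f \in faces Om.
Proof.
move=> /mem_Vint[xb [g gO xg] xf].
(* the faces around x, in cyclic order; y below is the other end of the edge
   between the faces number i and i + 1 *)
pose q i : zpoint := nth x [:: x; shift x 1 0; shift x 1 1; shift x 0 1] i.
have qs h : x \in corners h -> exists2 i, (i < 4)%N & h = q i.
  rewrite !inE => /or4P[] /eqP e.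
  - by exists 0%N; rewrite // /q /= e.
  - by exists 1%N; rewrite // /q /= e shiftD; apply/esym/shift0.
  - by exists 2%N; rewrite // /q /= e shiftD; apply/esym/shift0.
  - by exists 3%N; rewrite // /q /= e shiftD; apply/esym/shift0.
have st i : (i < 4)%N -> q i \in faces Om -> q (i.+1 %% 4)%N \in faces Om.
  move=> i4 qi; apply: enclosed_step (qi).
  pose y := nth x [:: shift x 0 (-1); shift x 1 0; shift x 0 1; shift x (-1) 0] i.
  apply: (@face_stepI _ _ x y _ _ _ _ _ _ xb); rewrite /y /q /adjL.
  1-6: move: i4 {xb xf xg qs gO y q qi}; case: x => p r;
    do 4?[case: i => [|i]] => //= _;
    by rewrite ?inE /shift /= ?xpair_eqE; lia.
have all4 i : (i < 4)%N -> q i \in faces Om ->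
    forall n, q ((i + n) %% 4)%N \in faces Om.
  move=> i4 qi; elim=> [|n IH]; first by rewrite addn0 modn_small.
  have := st _ (ltn_pmod (i + n) (isT : 0 < 4)%N) IH.
  by rewrite -addn1 modnDml addn1 addnS.
have [i i4 eg] := qs _ xg; have [j j4 ->] := qs _ xf.
have := all4 i i4; rewrite -eg => /(_ gO (4 - i + j)%N).
by rewrite addnA subnKC ?(ltnW i4) // modnDl modn_small.
Qed.

Lemma bdry_rightmost :
  exists2 x0 : zpoint, x0 \in bdry Om & forall y : zpoint, y \in bdry Om -> y.1 <= x0.1.
Proof.
have [+ _] := bdryP Om; case: (bdry Om) => // x s _.
elim: s x => [|y s IH] x.
  by exists x; rewrite ?inE // => y; rewrite inE => /eqP ->.
have [x0 x0s hx0] := IH y.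
have [h|h] := lerP x0.1 x.1.
  exists x; rewrite ?inE ?eqxx // => w; rewrite inE => /orP[/eqP -> //|/hx0 wx].
  exact: le_trans wx h.
exists x0; first by rewrite inE x0s orbT.
by move=> w; rewrite inE => /orP[/eqP -> |/hx0 //]; apply: ltW.
Qed.

(** Otherwise an enclosed face would lie to the right of the whole cycle, and
one could leave it towards infinity without meeting the cycle. *)
Lemma Vint_le (X : int) : (forall y : zpoint, y \in bdry Om -> y.1 <= X) ->
  forall x : zpoint, x \in Vint Om -> x.1 <= X.
Proof.
move=> hX x /mem_Vint[xb [f /facesP[N hN] xf]]; rewrite leNgt; apply/negP => Xx.
have Xf : X < f.1.
  by move: xf; case: f {hN} => p q; rewrite !inE => /or4P[] /eqP e; move: Xx; rewrite e /shift /=; lia.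
pose p n : seq zpoint := [seq shift f i.+1%:Z 0 | i <- iota 0 n].
have pP n : path (face_step (bdry Om)) f (p n) /\ last f (p n) = shift f n 0.
  elim: n => [|n [IH1 IH2]]; first by rewrite shift0.
  rewrite /p -addn1 iotaD map_cat add0n cats1 rcons_path last_rcons IH1 IH2.
  rewrite addn1; split=> //=.
  apply: (@face_stepI _ _ (shift f n 0) (shift f n (-1))).
  1-6: by case: f {hN IH1 IH2 p Xf xf} => r s; rewrite ?inE /adjL /shift /= ?xpair_eqE; lia.
  apply/negP => /hX; move: Xf; rewrite /shift /=; clear; case: f => r s /=; lia.
have [n Nn] : exists n : nat, N < f.1 + n%:Z.
  by exists ((absz (N - f.1)%R).+1); lia.
have [pn ln] := pP n; have := hN _ pn; rewrite ln /shift /=; lia.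
Qed.

(** Boundary vertices carry no [z], so the primitive takes the same value on the
two faces of colour [k] at such a vertex; consecutive vertices of the cycle
share a face of colour [k], so this value is constant along the cycle.  At the
rightmost vertex of the cycle it is 0. *)
Lemma domain_primitive (k : bool) (z : zpoint -> bool) :
  (forall x, z x -> x \in Vint Om) ->
  (forall f, colour f != k -> circ z f = false) ->
  exists B : zpoint -> bool,
    (forall x, grad k B x = z x) /\
    (forall w, w \in bfaces Om -> colour w = k -> B w = false).
Proof.
move=> zV zc; have [x0 x0b hx0] := bdry_rightmost.
have [B [BP B0]] := @plane_primitive k z x0.1 (fun x h => Vint_le hx0 (zV x h)) zc.
exists B; split=> // w.
(* both faces of colour k at a boundary vertex have the same value *)
have bV y : y \in bdry Om -> B (end1 k y) = B (end2 k y).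
  move=> yb; have := BP y; case: (boolP (z y)) => [/zV/mem_Vint[]|_].
    by rewrite yb.
  by rewrite /grad; case: (B _); case: (B _).
have step x y : x \in bdry Om -> y \in bdry Om -> adjL x y ->
    B (end1 k x) = B (end1 k y).
  move=> xb yb xy.
  suff [v vx vy] : exists2 v, v \in ends (diag k x) & v \in ends (diag k y).
    move: vx vy; rewrite !ends_diag !inE.
    by have := bV _ xb; have := bV _ yb; move=> ? ? /orP[]/eqP -> /orP[]/eqP ?; congruence.
  (* the two faces that share the edge xy have different colours *)
  have [d [xd yd xd' yd' dd']] : exists d : zpoint * zpoint,
      [/\ x \in corners d.1, y \in corners d.1, x \in corners d.2,
          y \in corners d.2 & colour d.2 = ~~ colour d.1].
    move: xy; clear; case: x y => p q [r s] xy.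
    pose d i j i' j' := (shift (p, q) i j, shift (p, q) i' j').
    have : [|| r == p + 1, r == p - 1, s == q + 1 | s == q - 1].
      by move: xy; rewrite /adjL /=; lia.
    case/or4P => /eqP e; [exists (d 1 0 1 1)|exists (d 0 0 0 1)
      |exists (d 0 1 1 1)|exists (d 0 0 1 0)].
    1-4: by split; rewrite /d ?inE /shift /colour /= ?xpair_eqE; move: xy; rewrite /adjL /=; lia.
  have [dk|dk] := eqVneq (colour d.1) k; first by exists d.1; rewrite mem_ends.
  have dk2 : colour d.2 = k by rewrite dd'; move: dk; case: (colour d.1); case: (k).
  by exists d.2; rewrite mem_ends.
have b0 : B (end1 k x0) = false.
  rewrite {1}/end1; case: eqP => xk; last by rewrite B0 // /shift /=; lia.
  have := bV _ x0b; rewrite /end1 /end2 xk eqxx => ->.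
  by rewrite B0 // /shift /=; lia.
have bc y : y \in bdry Om -> B (end1 k y) = false.
  move=> yb; have [_ /andP[cyc _]] := bdryP Om.
  have [i s e] := rot_to x0b.
  have : path.cycle adjL (x0 :: s) by rewrite -e rot_cycle.
  have {yb} : y \in x0 :: s by rewrite -e mem_rot.
  have : all (mem (bdry Om)) (x0 :: s) by apply/allP => u; rewrite -e mem_rot.
  rewrite /= => /andP[_]; rewrite rcons_path => + + /andP[+ _].
  elim: s x0 x0b b0 {e hx0 B0} => [|u s IH] x0 x0b b0 /=.
    by rewrite inE => _ /eqP ->.
  move=> /andP[ub sb]; rewrite inE => ys /andP[xu us].
  case/orP: ys => [/eqP -> //|ys]; apply: (IH u) => //.
  by rewrite -(step x0 u).
rewrite !inE => /andP[_ /hasP[x xw xb]] wk.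
move: xw; rewrite -(mem_ends x wk) ends_diag !inE => /orP[]/eqP ->.
  exact: bc.
by rewrite -bV // bc.
Qed.
End DomainGeometry.

(** * Splitting a cut along the signs of the other colour *)

(** The Fredholm alternative.  The columns of the cokernel matrix of [M] span the
vectors that [M] kills, and they detect the row space of [M]. *)
Lemma Fredholm (F : fieldType) (I J : finType) (M : J -> I -> F) (v : I -> F) :
  (forall z : I -> F, (forall j, \sum_i M j i * z i = 0) -> \sum_i v i * z i = 0) ->
  exists s : J -> F, forall i, \sum_j s j * M j i = v i.
Proof.
move=> H.
pose A : 'M[F]_(#|J|, #|I|) := \matrix_(j, i) M (enum_val j) (enum_val i).
pose w : 'rV[F]_#|I| := \row_i v (enum_val i).
have sumE (K : finType) (f : K -> F) : \sum_i f i = \sum_(i < #|K|) f (enum_val i).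
  by rewrite (reindex_onto enum_val enum_rank) => [|i _]; [apply: eq_bigl => i; rewrite enum_valK eqxx|rewrite enum_rankK].
have : (w <= A)%MS.
  rewrite submxE; apply/eqP/rowP => c.
  pose z i := cokermx A (enum_rank i) c.
  have zE n (B : 'M[F]_(n, #|I|)) j :
      (B *m cokermx A) j c = \sum_i B j (enum_rank i) * z i.
    by rewrite mxE [RHS]sumE; apply: eq_bigr => i _; rewrite /z !enum_valK.
  rewrite zE mxE -[RHS](H z) => [|j].
    by apply: eq_bigr => i _; rewrite mxE enum_rankK.
  have := congr1 (fun B : 'M[F]_(_, _) => B (enum_rank j) c) (mulmx_coker A).
  rewrite zE mxE => e; rewrite -[RHS]e.
  by apply: eq_bigr => i _; rewrite mxE !enum_rankK.
move=> /submxP[s e]; exists (fun j => s 0 (enum_rank j)) => i.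
have := congr1 (fun B : 'M[F]_(_, _) => B 0 (enum_rank i)) e; rewrite !mxE enum_rankK => ->.
by rewrite sumE; apply: eq_bigr => j _; rewrite !mxE !enum_valK enum_rankK.
Qed.

(* functions to F_2, as a finite additive group *)
HB.instance Definition _ (I : finType) := Finite.on {ffun I -> bool}.
HB.instance Definition _ (I : finType) := GRing.Zmodule.on {ffun I -> bool}.

(** The product formula for subgroups, the group law of [U] being its addition. *)
Lemma card_sumset (U : finZmodType) (A B : {set U}) :
    zmod_closed (mem A) -> zmod_closed (mem B) ->
  (#|A| * #|B| = #|[set (x + y)%R | x in A, y in B]| * #|A :&: B|)%N.
Proof.
move=> Az Bz.
have gr (D : {set U}) : zmod_closed (mem D) -> group_set D.
  move=> [D0 DB]; apply/group_setP; split=> // x y xD yD.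
  have nyD : - y \in D by rewrite -sub0r; apply: DB.
  by rewrite FinRing.zmodMgE -[y]opprK; apply: DB.
pose GA := Group (gr A Az); pose GB := Group (gr B Bz).
have := mul_cardG GA GB; rewrite /= => ->; congr (#|pred_of_set _| * _)%N.
Qed.

Section Counting.
Variable Om : domain.
Implicit Types (k : bool).

Lemma mem_V k (f : zpoint) : (f \in V Om k) = (f \in faces Om) && (colour f == k).
Proof. by rewrite !inE. Qed.

Lemma end1_V k (x : Vint Om) : end1 k (val x) \in V Om k.
Proof.
rewrite mem_V colour_end1 eqxx andbT; apply: (@Vint_face _ (val x)); first exact: valP.
by rewrite -(@mem_ends k) ?colour_end1 // ends_diag inE eqxx.
Qed.

Lemma end2_V k (x : Vint Om) : end2 k (val x) \in V Om k.
Proof.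
rewrite mem_V colour_end2 eqxx andbT; apply: (@Vint_face _ (val x)); first exact: valP.
by rewrite -(@mem_ends k) ?colour_end2 // ends_diag !inE eqxx orbT.
Qed.

Definition fend1 k (x : Vint Om) : V Om k := FSetSub (end1_V k x).
Definition fend2 k (x : Vint Om) : V Om k := FSetSub (end2_V k x).

Lemma end1_neq2 k x : end1 k x != end2 k x.
Proof.
rewrite /end1 /end2; case: x => p q; rewrite /shift /=.
by case: ifP => _; rewrite xpair_eqE; lia.
Qed.

Lemma agreeE k (s : spin Om k) (x : Vint Om) :
  agree s (diag k (val x)) = (s (fend1 k x) == s (fend2 k x)).
Proof.
rewrite /agree ends_diag; apply/'forall_forallP/idP => [h|/eqP h u v].
  by apply: (implyP (h _ _)); rewrite !inE !eqxx orbT.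
apply/implyP => /andP[]; rewrite !inE.
have e1 (u' : V Om k) : val u' = end1 k (val x) -> u' = fend1 k x.
  by move=> ?; apply: val_inj.
have e2 (u' : V Om k) : val u' = end2 k (val x) -> u' = fend2 k x.
  by move=> ?; apply: val_inj.
by do 2!move=> /orP[/eqP/e1|/eqP/e2] ->; rewrite ?h.
Qed.

Lemma val_corner k (u : V Om k) (x : Vint Om) :
  (val x \in corners (val u)) = (u == fend1 k x) (+) (u == fend2 k x).
Proof.
have uk : colour (val u) = k by have := valP u; rewrite mem_V => /andP[_ /eqP].
rewrite -(mem_ends _ uk) ends_diag !inE -!val_eqE /=.
move: (end1_neq2 k (val x)); case: (eqVneq (val u) (end1 k (val x))) => [->|_ _].
  by move=> /negbTE ->.
by rewrite addFb.
Qed.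

(** In this lemma and the next, the incidence between faces of colour [k] and
interior vertices is read from either side; together they give the summation by
parts of [cut_split_free]. *)
Lemma sum_ends k (x : Vint Om) (f : V Om k -> bool) :
  \sum_u f u * (val x \in corners (val u)) = f (fend1 k x) + f (fend2 k x).
Proof.
have e u : f u * (val x \in corners (val u)) =
    (if u == fend1 k x then f u else 0) + (if u == fend2 k x then f u else 0).
  rewrite val_corner; have : fend1 k x != fend2 k x by rewrite -val_eqE end1_neq2.
  case: (eqVneq u (fend1 k x)) => [->|_ _]; first by move=> /negbTE ->; case: (f _).
  by case: eqP; case: (f _).
by rewrite (eq_bigr _ (fun u _ => e u)) big_split /= -!big_mkcond !big_pred1_eq.
Qed.

Lemma sum_corners f (h : zpoint -> bool) :
  \sum_(x : Vint Om) (val x \in corners f) * h (val x) =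
  circ (fun p => (p \in Vint Om) && h p) f.
Proof.
have uc : uniq (corners f).
  case: f => p q; rewrite /corners /shift /= !inE !xpair_eqE; lia.
transitivity (\sum_(p <- corners f) ((p \in Vint Om) && h p)); last first.
  rewrite /corners !big_cons big_nil /circ addr0.
  by case: (_ && _) (_ && _) (_ && _) (_ && _) => -[] [] [].
transitivity (\sum_(x : Vint Om) \sum_(p <- corners f) (p == val x) * h p).
  apply: eq_bigr => x _; case: (boolP (val x \in corners f)) => [xf|xf].
    rewrite (bigD1_seq (val x)) //= eqxx big1; first by rewrite addr0.
    by move=> p /negbTE ->; rewrite mul0r.
  rewrite big_seq big1 ?mul0r // => p pf.
  by case: eqP => // e; rewrite -e pf in xf.
rewrite exchange_big /=; apply: eq_bigr => p _.
case: (boolP (p \in Vint Om)) => pV /=.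
  rewrite (bigD1 (FSetSub pV)) //= eqxx big1; first by rewrite addr0 mul1r.
  by move=> x; rewrite -val_eqE /= eq_sym => /negbTE ->; rewrite mul0r.
by rewrite big1 // => x _; case: eqP => [e|_]; [rewrite e (valP x) in pV|rewrite mul0r].
Qed.

Definition ext k (s : V Om k -> bool) (f : zpoint) : bool :=
  if insub f is Some u then s u else false.

Lemma ext_val k (s : V Om k -> bool) u : ext s (val u) = s u.
Proof. by rewrite /ext valK. Qed.

Lemma ext_out k (s : V Om k -> bool) f : f \notin V Om k -> ext s f = false.
Proof. by move=> h; rewrite /ext insubN. Qed.

Lemma grad_ext k (s : V Om k -> bool) (x : Vint Om) :
  grad k (ext s) (val x) = s (fend1 k x) (+) s (fend2 k x).
Proof. by rewrite /grad -!ext_val. Qed.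

Definition zero_on_bfaces k (s : V Om k -> bool) : bool :=
  [forall u : V Om k, (val u \in bfaces Om) ==> ~~ s u].

(** The edges at which [s] disagrees and whose dual edge of colour [k] has ends
where [t] is true, as a set of vertices of the lattice. *)
Definition restricted_cut k l (s : V Om l -> bool) (t : V Om k -> bool) (p : zpoint) :=
  (p \in Vint Om) && (grad l (ext s) p && ext t (end1 k p)).

Section Cut.
Variables (k : bool) (s : V Om (~~ k) -> bool) (t : V Om k -> bool).
Hypothesis st : forall x : Vint Om,
  s (fend1 (~~ k) x) (+) s (fend2 (~~ k) x) -> t (fend1 k x) = t (fend2 k x).

Let D := @restricted_cut k (~~ k) s t.

(** At the face [f] the condition on [t] is the same for all edges of the cut,
so the restricted cut is near [f] either empty or the full cut, which is even. *)
Lemma circ_restricted_cut f : colour f = k ->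
    (forall x, x \in corners f -> x \notin Vint Om -> grad (~~ k) (ext s) x = false) ->
  circ D f = false.
Proof.
move=> fk h.
have DE x : x \in corners f -> D x = grad (~~ k) (ext s) x && ext t f.
  move=> xf; rewrite /D /restricted_cut; case: (boolP (x \in Vint Om)) => [xV|/h->] //=.
  have -> : x = val (FSetSub xV) by [].
  rewrite grad_ext; case: (boolP (_ (+) _)) => //= g.
  have e := st g.
  have := xf; rewrite -(mem_ends x fk) ends_diag !inE.
  rewrite -[end1 _ _]/(val (fend1 k (FSetSub xV))) -[end2 _ _]/(val (fend2 k (FSetSub xV))).
  by rewrite ext_val => /orP[]/eqP ->; rewrite ext_val.
rewrite /circ !DE ?inE ?eqxx ?orbT //.
have kn : colour f != ~~ k by rewrite fk; case: (k).
move: (circ_grad (ext s) kn); rewrite /circ.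
by case: (ext t f); rewrite ?andbT ?andbF.
Qed.

(** Extended by 0, the configuration [s] has no gradient off the interior
vertices, so the restricted cut is even around every face of colour [k] of the
plane. *)
Lemma cut_split_wired : zero_on_bfaces s ->
  exists s' : V Om (~~ k) -> bool, zero_on_bfaces s' /\
    forall x : Vint Om, s' (fend1 (~~ k) x) (+) s' (fend2 (~~ k) x) =
      (s (fend1 (~~ k) x) (+) s (fend2 (~~ k) x)) && t (fend1 k x).
Proof.
move=> /forallP s0.
have s_out p x : colour p = ~~ k -> x \in corners p -> x \notin Vint Om -> ext s p = false.
  move=> pk xp xV; case: (boolP (p \in V Om (~~ k))) => [pV|/ext_out -> //].
  have -> : p = val (FSetSub pV) by [].
  rewrite ext_val; apply/negbTE/(implyP (s0 _)); rewrite !inE.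
  have pO : p \in faces Om by move: pV; rewrite mem_V => /andP[].
  rewrite pO andTb; apply/hasP; exists x => //.
  by apply: contraR xV => xb; apply/mem_Vint; split=> //; exists p.
have Dc f : colour f != ~~ k -> circ D f = false.
  move=> fk; apply: circ_restricted_cut; first by move: fk; case: (colour f); case: (k).
  move=> x xf xV; rewrite /grad !(s_out _ x) ?colour_end1 ?colour_end2 //.
    by rewrite -(mem_ends x (colour_end2 _ _)) ends_diag !inE eqxx orbT.
  by rewrite -(mem_ends x (colour_end1 _ _)) ends_diag !inE eqxx.
have [|B [BP B0]] := @domain_primitive Om (~~ k) D _ Dc; first by move=> x /andP[].
exists (fun u => B (val u)); split.
  apply/forallP => u; apply/implyP => ub; apply/negbT/B0 => //.
  by have := valP u; rewrite mem_V => /andP[_ /eqP].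
move=> x; have := BP (val x); rewrite /D /restricted_cut (valP x) /= grad_ext /grad => ->.
by rewrite -[end1 k _]/(val (fend1 k x)) ext_val.
Qed.

(** Pair the restricted cut with a set [z] of edges of colour [~~ k] that is even
at every face of that colour: [z] is the gradient of a function [B] on colour [k] that vanishes
on the boundary, and by summation by parts the pairing is the sum over faces u
of B(u) times the parity of the restricted cut around u.  One of the two factors
is 0, depending on whether u is on the boundary.  So the restricted cut is
orthogonal to all cycles, hence a cut. *)
Lemma cut_split_free :
  exists s' : V Om (~~ k) -> bool,
    forall x : Vint Om, s' (fend1 (~~ k) x) (+) s' (fend2 (~~ k) x) =
      (s (fend1 (~~ k) x) (+) s (fend2 (~~ k) x)) && t (fend1 k x).
Proof.
pose M (u : V Om (~~ k)) (x : Vint Om) : bool := val x \in corners (val u).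
have DE (x : Vint Om) : D (val x) =
    (s (fend1 (~~ k) x) (+) s (fend2 (~~ k) x)) && t (fend1 k x).
  rewrite /D /restricted_cut (valP x) /= grad_ext.
  by rewrite -[end1 k _]/(val (fend1 k x)) ext_val.
have [z Mz|s' s'E] := @Fredholm bool _ _ M (fun x => D (val x)); last first.
  by exists s' => x; rewrite -DE -s'E sum_ends.
pose Z p := if insub p is Some x then z x else false.
have ZE x : Z (val x) = z x by rewrite /Z valK.
have ZV p : Z p -> p \in Vint Om by rewrite /Z; case: insubP.
have kn : k != ~~ k by case: (k).
have Zc f : colour f != k -> circ Z f = false.
  move=> fk; have [fO|fO] := boolP (f \in faces Om); last first.
    have Z0 x : x \in corners f -> Z x = false.
      by move=> xf; apply/negP => /ZV xV; rewrite (Vint_face xV xf) in fO.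
    by rewrite /circ !Z0 // !inE eqxx ?orbT.
  have fV : f \in V Om (~~ k).
    by rewrite mem_V fO; move: fk; case: (colour f); case: (k).
  rewrite -[RHS](Mz (FSetSub fV)) (eq_bigr (fun x => M (FSetSub fV) x * Z (val x))).
    rewrite (sum_corners f Z) /circ.
    by congr (_ (+) _ (+) _ (+) _); rewrite andb_idl // => /ZV.
  by move=> x _; rewrite ZE.
have [B [BP B0]] := domain_primitive ZV Zc.
transitivity (\sum_(x : Vint Om) \sum_(u : V Om k)
    D (val x) * (B (val u) * (val x \in corners (val u)))).
  apply: eq_bigr => x _; rewrite -big_distrr; congr (_ * _).
  by rewrite sum_ends -ZE -BP.
rewrite exchange_big /= big1 // => u _.
have uk : colour (val u) = k by have := valP u; rewrite mem_V => /andP[_ /eqP].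
transitivity (B (val u) * \sum_(x : Vint Om) (val x \in corners (val u)) * D (val x)).
  by rewrite big_distrr; apply: eq_bigr => x _; rewrite mulrCA; congr (_ * _); rewrite mulrC.
have [/B0 -> //|ub] := boolP (val u \in bfaces Om).
rewrite sum_corners.
have -> : circ (fun p => (p \in Vint Om) && D p) (val u) = circ D (val u).
  by rewrite /circ /D /restricted_cut !andbA !andbb.
rewrite circ_restricted_cut ?mulr0 // => x xu /negP[].
apply/mem_Vint; split; last first.
  by exists (val u) => //; have := valP u; rewrite mem_V => /andP[].
apply: contra ub => xb; rewrite !inE; apply/andP; split; last by apply/hasP; exists x.
by have := valP u; rewrite mem_V => /andP[].
Qed.
End Cut.
End Counting.

(** * Counting compatible spin configurations *)

Section Compat.
Variable Om : domain.

Definition bc_spin (l : bool) (o : option bool) (s : spin Om l) : bool :=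
  if o is Some sgn
  then [forall u : V Om l, (val u \in bfaces Om) ==> (s u == sgn)] else true.

Definition compat (l : bool) (o : option bool) (xi : {ffun Vint Om -> bool}) :
    {set spin Om l} :=
  [set s | bc_spin o s &&
    [forall x : Vint Om, xi x || (s (fend1 l x) == s (fend2 l x))]].

Implicit Types (l : bool) (o : option bool) (A B xi : {ffun Vint Om -> bool}).

Lemma compatP l o xi (s : spin Om l) :
  reflect (bc_spin o s /\ forall x, ~~ xi x -> s (fend1 l x) = s (fend2 l x))
          (s \in compat l o xi).
Proof.
rewrite inE; apply: (iffP andP) => -[-> h]; split=> //.
  by move=> x xx; have := forallP h x; rewrite (negbTE xx) => /eqP.
by apply/forallP => x; case: (boolP (xi x)) => //= /h ->.
Qed.

(** Adding the boundary value to all spins turns the affine condition into a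
linear one. *)
Lemma card_compat_shift l o xi :
  #|compat l o xi| = #|compat l (omap (fun=> false) o) xi|.
Proof.
case: o => [sgn|] //=.
pose f (s : spin Om l) : spin Om l := [ffun u => s u (+) sgn].
have fK : involutive f by move=> s; apply/ffunP => u; rewrite !ffunE addbK.
rewrite -(card_imset (mem (compat l (Some sgn) xi)) (inv_inj fK)).
apply: eq_card => s; rewrite -[s]fK (mem_imset _ _ (inv_inj fK)) fK.
rewrite -{2}[s]fK.
move: (f s) => {}s; rewrite !inE /=; congr (_ && _); apply: eq_forallb => u; rewrite !ffunE.
  by congr (_ ==> _); case: (s u); case: sgn {f fK}.
by congr (_ || _); case: (s _); case: (s _); case: sgn {f fK}.
Qed.

Lemma card_compat_gt0 l o xi : (0 < #|compat l o xi|)%N.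
Proof.
apply/card_gt0P.
exists ([ffun=> odflt false o] : spin Om l); apply/compatP.
split=> [|x _]; last by rewrite !ffunE.
case: o => //= sgn; apply/forallP => u; rewrite ffunE /= eqxx; exact: implybT.
Qed.

Lemma compat_sub l o A B s : (forall x, A x -> B x) ->
  s \in compat l o A -> s \in compat l o B.
Proof.
move=> AB /compatP[s0 sA]; apply/compatP; split=> // x h.
by apply: sA; apply: contra h => /AB.
Qed.

Lemma card_compat_le l o A B : (forall x, A x -> B x) ->
  (#|compat l o A| <= #|compat l o B|)%N.
Proof.
by move=> AB; apply: subset_leq_card; apply/fintype.subsetP => s; apply: compat_sub.
Qed.

Lemma spinB l (s t : {ffun V Om l -> bool}) u : (s - t) u = s u (+) t u.
Proof. by rewrite !ffunE. Qed.

(** For the boundary value [true] this is a coset and not a subgroup. *)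
Lemma compat_closed l o xi : o != Some true ->
  zmod_closed (mem (compat l o xi : {set {ffun V Om l -> bool}})).
Proof.
move=> o0; split=> [|s t]; rewrite ?unfold_in.
  apply/compatP; split=> [|x _]; last by rewrite !ffunE.
  by case: o o0 => [[]|] // _; apply/forallP => u; rewrite ffunE implybT.
move=> /compatP[s0 sx] /compatP[t0 tx]; apply/compatP; split=> [|x xx]; last first.
  by rewrite !spinB sx ?tx.
case: o o0 s0 t0 => [[]|] // _ /forallP s0 /forallP t0; apply/forallP => u.
apply/implyP => ub; rewrite spinB.
by rewrite (eqP (implyP (s0 u) ub)) (eqP (implyP (t0 u) ub)).
Qed.

Lemma compatI l o A B : compat l o A :&: compat l o B = compat l o (ffand A B).
Proof.
apply/setP => s; apply/setIP/compatP => [[/compatP[s0 sA] /compatP[_ sB]]|[s0 h]].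
  by split=> // x; rewrite ffunE negb_and => /orP[/sA|/sB].
by split; apply/compatP; split=> // x xx; apply: h; rewrite ffunE (negbTE xx) ?andbF.
Qed.

Lemma compatD l o A B : o != Some true ->
  [set (s + t)%R | s in compat l o A, t in compat l o B] \subset
    (compat l o (ffor A B) : {set {ffun V Om l -> bool}}).
Proof.
move=> o0; apply/fintype.subsetP => u /imset2P[s t sA tB ->].
have [_ cl] := compat_closed l (ffor A B) o0.
have sAB : s \in compat l o (ffor A B).
  by apply: compat_sub sA => x xA; rewrite ffunE xA.
have tAB : t \in compat l o (ffor A B).
  by apply: compat_sub tB => x xB; rewrite ffunE xB orbT.
have -> : s + t = s - (0 - t) by rewrite sub0r opprK.
apply: (cl _ _ sAB); apply: (cl _ _ _ tAB).
by have [] := compat_closed l (ffor A B) o0.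
Qed.

(** Compare the orders of the two groups, their sum and their intersection; the
sum is contained in the group of the union. *)
Lemma card_compat_supermodular l o A B :
  (#|compat l o A| * #|compat l o B| <=
   #|compat l o (ffor A B)| * #|compat l o (ffand A B)|)%N.
Proof.
rewrite !(card_compat_shift l o); set o' := omap _ o.
have o0 : o' != Some true by rewrite /o'; case: (o).
have := card_sumset (compat_closed l A o0) (compat_closed l B o0).
move=> ->; rewrite compatI leq_mul2r; apply/orP; right.
exact/subset_leq_card/compatD.
Qed.

(** The sum of the two groups is all of the third one: the part [s1] of [s]
whose cut is the part of the cut of [s] on [A] is given by the splitting of
cuts, and [s - s1] is left with the part on [B]. *)
Lemma card_compat_split (k : bool) o (t : V Om k -> bool) A B :
    (forall x, A x -> t (fend1 k x) && t (fend2 k x)) ->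
    (forall x, B x -> ~~ t (fend1 k x) && ~~ t (fend2 k x)) ->
  (#|compat (~~ k) o A| * #|compat (~~ k) o B| =
   #|compat (~~ k) o (ffor A B)| * #|compat (~~ k) o [ffun=> false]|)%N.
Proof.
move=> At Bt.
have -> : [ffun=> false] = ffand A B.
  apply/ffunP => x; rewrite !ffunE; apply/esym/negbTE/negP => /andP[].
  by move=> /At/andP[h _] /Bt/andP[]; rewrite h.
rewrite !(card_compat_shift _ o); set o' := omap _ o.
have o0 : o' != Some true by rewrite /o'; case: (o).
have := card_sumset (compat_closed (~~ k) A o0) (compat_closed (~~ k) B o0).
move=> ->; rewrite compatI; congr (_ * _)%N; apply: eq_card; apply/subset_eqP.
rewrite compatD //=; apply/fintype.subsetP => s /compatP[s0 sAB].
have st (x : Vint Om) : s (fend1 (~~ k) x) (+) s (fend2 (~~ k) x) ->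
    t (fend1 k x) = t (fend2 k x).
  move=> h; have : ffor A B x.
    by apply: contraTT h => /sAB ->; rewrite addbb.
  rewrite ffunE => /orP[/At|/Bt] /andP[]; first by move=> -> ->.
  by move=> /negbTE -> /negbTE ->.
(* a boundary condition, if any, now prescribes the value false *)
have [s' [s'0 s'E]] : exists s' : V Om (~~ k) -> bool,
    (o' = Some false -> zero_on_bfaces s') /\
    forall x : Vint Om, s' (fend1 (~~ k) x) (+) s' (fend2 (~~ k) x) =
      (s (fend1 (~~ k) x) (+) s (fend2 (~~ k) x)) && t (fend1 k x).
  case: (o') o0 s0 => [[]|] // _ s0.
    have [|s' [h1 h2]] := cut_split_wired st; last by exists s'.
    by apply: etrans s0; apply: eq_forallb => u; case: (s u).
  by have [s' h] := cut_split_free st; exists s'.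
pose s1 : {ffun V Om (~~ k) -> bool} := [ffun u => s' u].
have s1bc : bc_spin o' s1.
  case: (o') o0 s'0 => [[]|] // _ /(_ erefl) h.
  by apply: etrans h; apply: eq_forallb => u; rewrite ffunE; case: (s' u).
have s1A : s1 \in compat (~~ k) o' A.
  apply/compatP; split=> // x xA; apply/eqP.
  rewrite -[_ == _]negbK -[~~ (_ == _)]/(_ != _); rewrite -negb_add negbK !ffunE s'E.
  apply/negP => /andP[h tx].
  have : ffor A B x by apply: contraTT h => /sAB ->; rewrite addbb.
  by rewrite ffunE (negbTE xA) => /Bt/andP[]; rewrite tx.
apply/imset2P; exists s1 (s - s1 : {ffun _ -> bool}) => //; last by rewrite addrC subrK.
have sAB' : s \in compat (~~ k) o' (ffor A B) by apply/compatP.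
have s1AB : s1 \in compat (~~ k) o' (ffor A B).
  by apply: compat_sub s1A => x xA; rewrite ffunE xA.
have [_ /(_ s s1 sAB' s1AB)/compatP[bc0 hAB]] := compat_closed (~~ k) (ffor A B) o0.
apply/compatP; split=> // x xB; have [xA|xA] := boolP (A x); last first.
  by apply: hAB; rewrite ffunE (negbTE xA).
have /andP[tx _] := At x xA; have := s'E x; rewrite tx andbT !spinB !ffunE.
by case: (s' _); case: (s' _); case: (s _); case: (s _).
Qed.
End Compat.

(** * The coupled percolations and their lattice condition *)

(** The image of a product weight under a map acting coordinatewise is a product
weight. *)
Lemma sum_pushforward (R : comNzRingType) (I B : finType) (w : I -> B -> R)
    (r : I -> B -> bool) (F : {ffun I -> bool} -> R) :
  \sum_(be : {ffun I -> B}) (\prod_x w x (be x)) * F [ffun x => r x (be x)] =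
  \sum_(xi : {ffun I -> bool}) (\prod_x \sum_(b | r x b == xi x) w x b) * F xi.
Proof.
rewrite (partition_big (fun be : {ffun I -> B} => [ffun x => r x (be x)]) predT) //=.
apply: eq_bigr => xi _; rewrite bigA_distr_big_dep big_distrl /=.
apply: eq_big => [be|be /eqP -> //]; apply/eqP/familyP => [<- x|h].
  by rewrite unfold_in /= ffunE.
by apply/ffunP => x; rewrite ffunE; apply/eqP/(h x).
Qed.

Lemma prod_natr_bool (R : comNzRingType) (I : finType) (b : I -> bool) :
  \prod_x (b x)%:R = [forall x, b x]%:R :> R.
Proof.
case: (boolP [forall x, b x]) => [/forallP h|/forallPn[x /negbTE h]].
  by rewrite big1 // => x _; rewrite h.
by rewrite (bigD1 x) //= h mul0r.
Qed.

Section Weights.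
Variables (R : realFieldType) (Om : domain) (k : bool) (o : option bool).
Variables (p q : Vint Om -> R).
Hypothesis p01 : forall x, 0 <= p x <= 1.
Hypothesis q01 : forall x, 0 <= q x <= 1.
Implicit Types (t : spin Om k) (z xi : {ffun Vint Om -> bool}).

Definition plus_part t z : {ffun Vint Om -> bool} :=
  [ffun x => [&& z x, t (fend1 k x) & t (fend2 k x)]].
Definition minus_part t z : {ffun Vint Om -> bool} :=
  [ffun x => [&& z x, ~~ t (fend1 k x) & ~~ t (fend2 k x)]].

Definition bernoulli_weight (z : {ffun Vint Om -> bool}) : R :=
  \prod_x (if z x then p x else 1 - p x).

Definition cut_weight (t : spin Om k) : R :=
  \prod_x (if t (fend1 k x) == t (fend2 k x) then 1 else q x).

Definition ncompat (xi : {ffun Vint Om -> bool}) : R := #|compat (~~ k) o xi|%:R.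

Lemma bernoulli_weight_ge0 z : 0 <= bernoulli_weight z.
Proof.
by apply: prodr_ge0 => x _; have /andP[p0 p1] := p01 x; case: ifP; rewrite ?subr_ge0.
Qed.

Lemma bernoulli_weightM z z' :
  bernoulli_weight z * bernoulli_weight z' =
  bernoulli_weight (ffor z z') * bernoulli_weight (ffand z z').
Proof.
rewrite /bernoulli_weight -!big_split; apply: eq_bigr => x _; rewrite !ffunE /=.
by case: (z x); case: (z' x) => //=; rewrite mulrC.
Qed.

Lemma cut_weight_ge0 t : 0 <= cut_weight t.
Proof. by apply: prodr_ge0 => x _; have /andP[q0 _] := q01 x; case: ifP. Qed.

(** An edge with spins (+,-) in one configuration and (-,+) in the other agrees
in the join and the meet, which costs nothing as q <= 1; in all other cases the
two sides are equal. *)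
Lemma cut_weightM t t' :
  cut_weight t * cut_weight t' <= cut_weight (ffor t t') * cut_weight (ffand t t').
Proof.
rewrite /cut_weight -!big_split /=; apply: ler_prod => x _; rewrite !ffunE /=.
have /andP[q0 q1] := q01 x; have qq : q x * q x <= 1 by apply: mulr_ile1.
by case: (t _); case: (t _); case: (t' _); case: (t' _);
  rewrite ?eqxx ?[true == false]/= ?[false == true]/= ?mul1r ?mulr1 ?ler01 ?q0 ?q1 ?lexx ?qq ?mulr_ge0.
Qed.

Lemma ncompatM xi xi' :
  ncompat xi * ncompat xi' <= ncompat (ffor xi xi') * ncompat (ffand xi xi').
Proof. by rewrite /ncompat -!natrM ler_nat card_compat_supermodular. Qed.

Lemma ncompat_le xi xi' : (forall x, xi x -> xi' x) -> ncompat xi <= ncompat xi'.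
Proof. by move=> h; rewrite /ncompat ler_nat card_compat_le. Qed.

(** A spin configuration and two percolations, of which the second is ordered by
reverse inclusion. *)
Definition coupling : finType :=
  (spin Om k * ({ffun Vint Om -> bool} * {ffun Vint Om -> bool}))%type.

Definition coupling_join (x y : coupling) : coupling :=
  (ffor x.1 y.1, (ffor x.2.1 y.2.1, ffand x.2.2 y.2.2)).
Definition coupling_meet (x y : coupling) : coupling :=
  (ffand x.1 y.1, (ffand x.2.1 y.2.1, ffor x.2.2 y.2.2)).

Definition coupling_weight (x : coupling) : R :=
  cut_weight x.1 * (bernoulli_weight x.2.1 * bernoulli_weight x.2.2) *
  (ncompat (plus_part x.1 x.2.1) * ncompat (minus_part x.1 x.2.2)).

Lemma coupling_weight_ge0 x : 0 <= coupling_weight x.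
Proof.
by rewrite !mulr_ge0 ?bernoulli_weight_ge0 ?cut_weight_ge0 // /ncompat ler0n.
Qed.

(** Keeping only the edges with two plus ends is monotone and commutes with meets,
but the join of two configurations has further plus edges, and the meet further
minus edges; these are harmless because [ncompat] is increasing. *)
Lemma coupling_weightM x y :
  coupling_weight x * coupling_weight y <=
  coupling_weight (coupling_join x y) * coupling_weight (coupling_meet x y).
Proof.
case: x y => [t [zp zm]] [t' [zp' zm']]; rewrite /coupling_weight /=.
have n0 xi : 0 <= ncompat xi by rewrite /ncompat ler0n.
have hp : ncompat (plus_part t zp) * ncompat (plus_part t' zp') <=
    ncompat (plus_part (ffor t t') (ffor zp zp')) *
    ncompat (plus_part (ffand t t') (ffand zp zp')).
  apply: le_trans (ncompatM _ _) _; apply: ler_pM => //; apply: ncompat_le => x;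
    rewrite !ffunE.
    by case/orP => /and3P[-> -> ->]; rewrite ?orbT.
  by case/andP => /and3P[-> -> ->] /and3P[-> -> ->].
have hm : ncompat (minus_part t zm) * ncompat (minus_part t' zm') <=
    ncompat (minus_part (ffor t t') (ffand zm zm')) *
    ncompat (minus_part (ffand t t') (ffor zm zm')).
  apply: le_trans (ncompatM _ _) _; rewrite mulrC.
  apply: ler_pM => //; apply: ncompat_le => x; rewrite !ffunE.
    by case/andP => /and3P[-> /negbTE -> /negbTE ->] /and3P[-> /negbTE -> /negbTE ->].
  by case/orP => /and3P[-> /negbTE -> /negbTE ->]; rewrite ?orbT ?andbF.
rewrite mulrACA [leRHS]mulrACA; apply: ler_pM.
- by rewrite !mulr_ge0 ?bernoulli_weight_ge0 ?cut_weight_ge0.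
- by rewrite !mulr_ge0.
- rewrite mulrACA [leRHS]mulrACA; apply: ler_pM.
  + by rewrite !mulr_ge0 ?cut_weight_ge0.
  + by rewrite !mulr_ge0 ?bernoulli_weight_ge0.
  + exact: cut_weightM.
  + by rewrite mulrACA [leRHS]mulrACA (bernoulli_weightM zp) (bernoulli_weightM zm) [bernoulli_weight (ffand zm _) * _]mulrC.
- by rewrite mulrACA [leRHS]mulrACA; apply: ler_pM => //; rewrite !mulr_ge0.
Qed.

Lemma four_functions_coupling : four_functions R coupling_join coupling_meet.
Proof.
have ff (I : finType) := @four_functions_ffun R I.
exact: (four_functions_prod (ff _)
          (four_functions_prod (ff _) (four_functions_dual (ff _)))).
Qed.

Definition open_edges (x : coupling) : {ffun Vint Om -> bool} :=
  ffor (plus_part x.1 x.2.1) (minus_part x.1 x.2.2).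

(** The weight of the spins and the percolation of one colour, without the factor
[ncompat] coming from the other colour. *)
Definition joint_weight t xi : R :=
  \prod_x (let agr := t (fend1 k x) == t (fend2 k x) in
           if xi x then agr%:R * p x else if agr then 1 - p x else q x).

(** At an edge where [t] agrees, one of the two percolations decides and the
other one is summed out; where [t] disagrees, both are summed out and the edge
is closed. *)
Lemma sum_coupling t (H : {ffun Vint Om -> bool} -> R) :
  \sum_(z : {ffun Vint Om -> bool} * {ffun Vint Om -> bool})
    cut_weight t * (bernoulli_weight z.1 * bernoulli_weight z.2) * H (open_edges (t, z)) =
  \sum_(xi : {ffun Vint Om -> bool}) joint_weight t xi * H xi.
Proof.
pose h (be : {ffun Vint Om -> bool * bool}) :
    {ffun Vint Om -> bool} * {ffun Vint Om -> bool} :=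
  ([ffun x => (be x).1], [ffun x => (be x).2]).
pose h' (z : {ffun Vint Om -> bool} * {ffun Vint Om -> bool}) :
    {ffun Vint Om -> bool * bool} := [ffun x => (z.1 x, z.2 x)].
rewrite (reindex h); last first.
  exists h' => [be _|[z1 z2] _]; first by apply/ffunP => x; rewrite !ffunE; case: (be x).
  by congr (_, _); apply/ffunP => x; rewrite !ffunE.
pose w x (b : bool * bool) := (if t (fend1 k x) == t (fend2 k x) then 1 else q x) *
  ((if b.1 then p x else 1 - p x) * (if b.2 then p x else 1 - p x)).
pose r x (b : bool * bool) := [&& b.1, t (fend1 k x) & t (fend2 k x)] ||
  [&& b.2, ~~ t (fend1 k x) & ~~ t (fend2 k x)].
transitivity (\sum_(be : {ffun Vint Om -> bool * bool})
    (\prod_x w x (be x)) * H [ffun x => r x (be x)]).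
  apply: eq_bigr => be _; congr (_ * H _).
    rewrite /cut_weight /bernoulli_weight -!big_split; apply: eq_bigr => x _.
    by rewrite /w /= !ffunE.
  by apply/ffunP => x; rewrite !ffunE.
rewrite sum_pushforward; apply: eq_bigr => xi _; congr (_ * _).
apply: eq_bigr => x _; rewrite big_mkcond.
have pairE (f : bool * bool -> R) :
    \sum_b f b = f (true, true) + f (true, false) + (f (false, true) + f (false, false)).
  rewrite (eq_bigr (fun b => f (b.1, b.2))) => [|[]] //.
  by rewrite -(pair_bigA _ (fun i j => f (i, j))) big_bool /= !big_bool.
rewrite pairE /w /r /=.
by case: (t _); case: (t _); case: (xi x); rewrite /=; ring.
Qed.

(** At an open edge the total weight p does not depend on whether [s] agrees,
and at a closed edge [s] must agree; hence only the number of compatible [s]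
remains. *)
Lemma sum_joint_weight t (H : {ffun Vint Om -> bool} -> R) :
  \sum_(xi : {ffun Vint Om -> bool}) joint_weight t xi * (ncompat xi * H xi) =
  \sum_(s : spin Om (~~ k) | bc_spin o s) \sum_(be : {ffun Vint Om -> bool})
    (\prod_x (let agr := t (fend1 k x) == t (fend2 k x) in
              let agr' := s (fend1 (~~ k) x) == s (fend2 (~~ k) x) in
              (agr || agr')%:R * (if ~~ agr then q x else if ~~ agr' then p x else 1) *
              (if be x then p x else 1 - p x))) *
    H [ffun x => let agr := t (fend1 k x) == t (fend2 k x) in
              let agr' := s (fend1 (~~ k) x) == s (fend2 (~~ k) x) in
              if ~~ agr then false else if ~~ agr' then true else be x].
Proof.
under [RHS]eq_bigr => s _.
  rewrite (@sum_pushforward _ _ _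
    (fun x b => let agr := t (fend1 k x) == t (fend2 k x) in
              let agr' := s (fend1 (~~ k) x) == s (fend2 (~~ k) x) in
              (agr || agr')%:R * (if ~~ agr then q x else if ~~ agr' then p x else 1) *
              (if b then p x else 1 - p x))
    (fun x b => let agr := t (fend1 k x) == t (fend2 k x) in
              let agr' := s (fend1 (~~ k) x) == s (fend2 (~~ k) x) in
              if ~~ agr then false else if ~~ agr' then true else b) H) /=.
  under eq_bigr => xi _.
    rewrite (eq_bigr (fun x => (let agr := t (fend1 k x) == t (fend2 k x) in
           if xi x then agr%:R * p x else if agr then 1 - p x else q x) *
           (xi x || (s (fend1 (~~ k) x) == s (fend2 (~~ k) x)))%:R)); last first.
      move=> x _; rewrite big_mkcond big_bool /=.
      by case: (t _ == t _); case: (s _ == s _); case: (xi x); rewrite /=; ring.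
    rewrite big_split /= prod_natr_bool -/(joint_weight t xi).
    over.
  over.
rewrite exchange_big /=; apply: eq_bigr => xi _.
rewrite mulrCA [LHS]mulrC /ncompat -sum1_card natr_sum big_distrr /=.
rewrite big_mkcond [RHS]big_mkcond /=; apply: eq_bigr => s _.
rewrite inE; case: (bc_spin o s) => //=.
by case: [forall x, _]; rewrite /= ?mulr1 ?mulr0 ?mul0r.
Qed.

End Weights.

(** * Expectations under the extended measures *)

Local Open Scope classical_set_scope.

Lemma uniform_prob_le (R : realType) (r : R) : 0 <= r <= 1 ->
  uniform_prob (@ltr01 R) [set u | u <= r] = r%:E.
Proof.
move=> /andP[r0 r1]; rewrite /uniform_prob integral_uniform_pdf.
have -> : [set u | u <= r] `&` `[0, 1]%classic = `[0, r]%classic :> set R.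
  apply/seteqP; split=> x /=; rewrite !in_itv /=; first by move=> [-> /andP[-> _]].
  by move=> /andP[-> xr]; rewrite xr (le_trans xr r1).
rewrite (eq_integral (fun=> 1%:E)); last first.
  move=> x; rewrite inE /= in_itv /= => /andP[x0 xr].
  by rewrite /uniform_pdf x0 (le_trans xr r1) subr0 invr1.
rewrite integral_cst //= lebesgue_measure_itv /= lte_fin mul1e.
by case: ltP => h; rewrite ?sube0 //; congr (_%:E); apply/eqP; rewrite eq_le r0 h.
Qed.

Lemma uniform_prob_setC (R : realType) (B : set R) (r : R) : measurable B ->
  uniform_prob (@ltr01 R) B = r%:E -> uniform_prob (@ltr01 R) (~` B) = (1 - r)%:E.
Proof.
move=> mB Br; transitivity (1 - uniform_prob (@ltr01 R) B)%E; last by rewrite Br.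
exact: (probability_setC (uniform_prob (@ltr01 R))).
Qed.

Lemma expectation_finite (R : realType) (d : measure_display) (T : measurableType d)
    (P : probability T R) (Y : finType) (X : T -> Y) (pr F : Y -> R) :
    (forall y, measurable (X @^-1` [set y])) ->
    (forall y, P (X @^-1` [set y]) = (pr y)%:E) ->
  'E_P[fun t => F (X t)]%E = (\sum_y pr y * F y)%:E.
Proof.
move=> mX PX; rewrite unlock.
rewrite (eq_integral (fun t => \sum_y (F y)%:E * (\1_(X @^-1` [set y]) t)%:E))%E; last first.
  move=> t _; rewrite (bigD1 (X t)) //= big1 ?adde0.
    by rewrite indicE mem_set // mule1.
  move=> y yX; rewrite indicE memNset ?mule0 //= => /esym e.
  by rewrite e eqxx in yX.
have int y : P.-integrable [set: T] (fun t => (\1_(X @^-1` [set y]) t)%:E).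
  exact: integrable_indic.
rewrite integral_sum //; last by move=> y; apply: integrableZl => //.
rewrite -sumEFin; apply: eq_bigr => y _.
rewrite integralZl // integral_indic // setIT [pr y * _]mulrC EFinM.
by congr (_ * _)%E; apply: PX.
Qed.

Section Expectation.
Context (R : realType) (d : measure_display) (T : measurableType d).
Variables (P : probability T R) (Om : domain) (mu : config Om -> R).
Variables (S : T -> config Om) (U : Vint Om -> {RV P >-> R}).
Hypothesis law : extends_law mu S U.
Variables (p : Vint Om -> R) (B : Vint Om -> set R).
Hypothesis mB : forall x, measurable (B x).
Hypothesis UB : forall x, uniform_prob (@ltr01 R) (B x) = (p x)%:E.

(** Only the events that the uniform variables fall into the sets [B x] matter,
and given the spins these are independent with probabilities [p x]. *)
Lemma expectation_law (F : config Om -> {ffun Vint Om -> bool} -> R) :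
  'E_P[fun t => F (S t) [ffun x => `[< B x (U x t) >]]]%E =
  (\sum_s \sum_be mu s * bernoulli_weight p be * F s be)%:E.
Proof.
have [mS PS] := law.
pose X t : config Om * {ffun Vint Om -> bool} := (S t, [ffun x => `[< B x (U x t) >]]).
pose C (be : {ffun Vint Om -> bool}) x : set R := if be x then B x else ~` B x.
have mC be x : measurable (C be x).
  by rewrite /C; case: ifP => // _; apply: measurableC.
have XE y : X @^-1` [set y] =
    S @^-1` [set y.1] `&` \bigcap_(x in [set: Vint Om]) (U x @^-1` C y.2 x).
  apply/seteqP; split=> [t|t []] /=.
    move=> <-; split=> // x _; rewrite /C /= ffunE.
    by case: asboolP.
  case: y => s be /= <- h; congr (_, _); apply/ffunP => x; rewrite ffunE.
  have := h x I; rewrite /C /=; case: (be x) => [?|?]; first exact/asboolP.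
  exact/asboolPn.
rewrite (@expectation_finite _ _ _ P _ X (fun y => mu y.1 * bernoulli_weight p y.2) (fun y => F y.1 y.2)).
- by congr (_%:E); rewrite (pair_bigA _ (fun s be => mu s * bernoulli_weight p be * F s be)).
- move=> y; rewrite XE; apply: measurableI; first exact: mS.
  apply: fin_bigcap_measurable => [|x _]; [exact: finite_finset|rewrite -[_ @^-1` _]setTI].
  exact: measurable_funPT.
- move=> y; rewrite XE PS // EFinM; congr (_ * _)%E.
  rewrite /bernoulli_weight -prodEFin; apply: eq_bigr => x _; rewrite /C.
  case: ifP => _; first exact: UB.
  exact: uniform_prob_setC.
Qed.

End Expectation.
Local Close Scope classical_set_scope.

(** * From the measures on spins to the coupling *)

Local Open Scope fset_scope.
Local Open Scope ring_scope.

Section Weight.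
Variables (R : realType) (a b c : R) (Om : domain).

(** In a consistent configuration at most one of the two edges through each
vertex carries a weight. *)
Lemma spin_weightE (s : config Om) : consistent s ->
  spin_weight a b c s = \prod_(x : Vint Om)
    (if ~~ agree s.1 (diag true (val x)) then edge_par a b c (diag false (val x))
     else if ~~ agree s.2 (diag false (val x)) then edge_par a b c (diag true (val x))
     else 1).
Proof.
move=> /forallP cs; rewrite /spin_weight.
set w := omega s.1 `|` omega s.2.
(* each power is a product over the edges it counts *)
have powE (P : pred edge) (r : R) :
    r ^+ #|` [fset e in w | P e]| = \prod_(e <- w | P e) r.
  by rewrite big_fset_condE big_const_seq count_predT iter_mulr_1.
rewrite !powE.
transitivity (\prod_(e <- w) edge_par a b c e).
  rewrite [RHS](bigID in_Ea) /=; congr (_ * _); apply: eq_bigr => e.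
    by rewrite /edge_par => ->.
  by rewrite /edge_par => /negbTE ->.
pose D (x : zpoint) := ~~ agree s.1 (diag true x) || ~~ agree s.2 (diag false x).
(* the edge through x that carries a weight, if there is one *)
pose h (x : zpoint) := if ~~ agree s.1 (diag true x) then diag false x else diag true x.
have wE : w = [fset h x | x in [fset x in Vint Om | D x]].
  apply/fsetP => e; apply/idP/imfsetP => /=.
    rewrite inE => /orP[]/imfsetP[x /=]; rewrite inE => /andP[xV xs] ->; exists x.
    - by rewrite inE /= inE /= xV /D xs.
    - by rewrite /h xs.
    - by rewrite inE /= inE /= xV /D xs orbT.
    - have := cs (FSetSub xV); rewrite /= (negbTE xs) orbF => x1.
      by rewrite /h x1.
  move=> [x]; rewrite inE /= inE /= => /andP[xV xD] ->; rewrite /h inE.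
  case: ifP => [x1|/negbFE x1]; apply/orP; [left|right]; apply/imfsetP; exists x => //=.
    by rewrite inE xV.
  by move: xD; rewrite inE xV /D x1.
rewrite wE big_imfset /=; last first.
  by move=> x y _ _; rewrite /h; do 2!case: ifP => _; case.
rewrite -big_fset_condE big_seq_fsetE /= big_mkcond; apply: eq_bigr => x _.
by rewrite /D /h; case: (agree s.1 _) => //=; case: (agree s.2 _).
Qed.

Definition mk_config (k : bool) : spin Om k -> spin Om (~~ k) -> config Om :=
  match k with
  | true => fun t s => (t, s)
  | false => fun t s => (s, t)
  end.

Lemma proj_mk k (t : spin Om k) (s : spin Om (~~ k)) : proj (mk_config t s) k = t.
Proof. by case: k t s. Qed.

Lemma proj_mkN k (t : spin Om k) (s : spin Om (~~ k)) : proj (mk_config t s) (~~ k) = s.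
Proof. by case: k t s. Qed.

Lemma sum_config k (F : config Om -> R) :
  \sum_s F s = \sum_(t : spin Om k) \sum_(s : spin Om (~~ k)) F (mk_config t s).
Proof.
case: k => /=; last rewrite exchange_big /=; rewrite pair_bigA; by apply: eq_bigr => -[].
Qed.

Definition diag_par k (x : Vint Om) : R := edge_par a b c (diag k (val x)).

Lemma weight_mk k (t : spin Om k) (s : spin Om (~~ k)) :
  (consistent (mk_config t s))%:R * spin_weight a b c (mk_config t s) =
  \prod_x (let agr := t (fend1 k x) == t (fend2 k x) in
           let agr' := s (fend1 (~~ k) x) == s (fend2 (~~ k) x) in
           (agr || agr')%:R *
           (if ~~ agr then diag_par (~~ k) x else if ~~ agr' then diag_par k x else 1)).
Proof.
have E : consistent (mk_config t s) = [forall x : Vint Om,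
    (t (fend1 k x) == t (fend2 k x)) || (s (fend1 (~~ k) x) == s (fend2 (~~ k) x))].
  apply: eq_forallb => x; case: k t s => t s /=; rewrite !agreeE //; exact: orbC.
rewrite [RHS]big_split /= prod_natr_bool -E.
case: (boolP (consistent _)) => [cs|_]; last by rewrite !mul0r.
congr (_ * _); rewrite spin_weightE //; move: cs; rewrite E => /forallP cs.
apply: eq_bigr => x _; have := cs x; rewrite /diag_par.
by case: k t s {E cs} => t s /=; rewrite !agreeE //; do 2!case: (_ == _).
Qed.

(** The percolation of colour [k] when the bit [be x] replaces the event on the
uniform variable at [x]. *)
Definition xi_of_bits k (s : config Om) (be : {ffun Vint Om -> bool}) :
    {ffun Vint Om -> bool} :=
  [ffun x => if ~~ agree s.1 (diag true (val x)) then ~~ k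
             else if ~~ agree s.2 (diag false (val x)) then k else be x].

Variables (k : bool) (o : option bool) (C : pred (spin Om k)) (K : R).
Variable mu : config Om -> R.
Hypothesis muE : forall s, mu s =
  K * (C (proj s k) && bc_spin o (proj s (~~ k)))%:R * ((consistent s)%:R * spin_weight a b c s).

Let p := diag_par k.
Let q := diag_par (~~ k).
Let N0 := ncompat R k o ([ffun=> false] : {ffun Vint Om -> bool}).

(** The law of the spins and the percolation of colour [k], first summed over
the spins of colour [~~ k] and then written through the coupling. *)
Lemma sum_config_coupling (H : spin Om k -> {ffun Vint Om -> bool} -> R) :
  \sum_s \sum_be mu s * bernoulli_weight p be * H (proj s k) (xi_of_bits k s be) =
  K / N0 * \sum_(x : coupling Om k)
    (C x.1)%:R * coupling_weight o p q x * H x.1 (open_edges x).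
Proof.
have N00 : N0 != 0 by rewrite /N0 /ncompat pnatr_eq0 -lt0n card_compat_gt0.
rewrite (sum_config k).
rewrite -(pair_bigA _ (fun t z => (C t)%:R * coupling_weight o p q (t, z) * H t (open_edges (t, z)))) /=.
rewrite big_distrr /=; apply: eq_bigr => t _.
transitivity (K * (C t)%:R * \sum_(xi : {ffun Vint Om -> bool})
    joint_weight p q t xi * (ncompat R k o xi * H t xi)).
  rewrite sum_joint_weight [in RHS]big_mkcond big_distrr /=; apply: eq_bigr => s _.
  case: (boolP (bc_spin o s)) => bs; last first.
    by rewrite mulr0 big1 // => be _; rewrite muE proj_mkN (negbTE bs) andbF mulr0 !mul0r.
  rewrite big_distrr /=; apply: eq_bigr => be _.
  rewrite muE proj_mkN proj_mk bs andbT weight_mk -!mulrA; congr (_ * (_ * _)).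
  rewrite mulrA -big_split /=; have [cs|] := boolP (consistent (mk_config t s)).
    congr (_ * H _ _); apply/ffunP => x; rewrite !ffunE.
    have /forallP/(_ x) := cs.
    by case: k t s {cs bs} be => t s be /=; rewrite !agreeE; do 2!case: (_ == _).
  move=> ncs; have := weight_mk t s; rewrite (negbTE ncs) mul0r => z.
  by rewrite big_split /= -z !mul0r.
rewrite -sum_coupling !big_distrr /=; apply: eq_bigr => z _.
rewrite /coupling_weight /=.
have -> : ncompat R k o (plus_part t z.1) * ncompat R k o (minus_part t z.2) =
    ncompat R k o (open_edges (t, z)) * N0.
  rewrite /N0 /ncompat -!natrM; congr (_%:R); apply: (@card_compat_split Om k o t) => x;
    by rewrite ffunE => /andP[].
by field.
Qed.
End Weight.

Section Triplet.
Variables (R : realType) (a b c : R) (Om : domain) (k : bool).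

Lemma edge_vertex_in (e : E Om k) : (val e).1 \in Vint Om.
Proof. by have /imfsetP[x /= xV ->] := valP e. Qed.

Definition edge_vertex (e : E Om k) : Vint Om := FSetSub (edge_vertex_in e).

Lemma edge_vertexE e : val e = diag k (val (edge_vertex e)).
Proof. by rewrite /edge_vertex /=; have /imfsetP[x /= xV ->] := valP e. Qed.

(** The triplet as a function of the spins and the percolation of its colour. *)
Definition signed_edges (t : spin Om k) (xi : {ffun Vint Om -> bool}) (i : tindex Om k) : R :=
  match i with
  | IV u => if t u then 1 else -1
  | IEplus e => (plus_part t xi (edge_vertex e))%:R
  | IEminus e => - (minus_part t xi (edge_vertex e))%:R
  end.

Lemma tripletE s (U : Vint Om -> R) (be : {ffun Vint Om -> bool}) :
  (forall x, be x = if k then U x <= diag_par a b c k x else U x > 1 - diag_par a b c k x) ->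
  @triplet Om R a b c k s U = signed_edges (proj s k) (xi_of_bits k s be).
Proof.
move=> beE; apply/funext => i.
have sgnE sgn (e : E Om k) : (val e \in xi_sgn a b c k sgn s U) =
    [&& xi_of_bits k s be (edge_vertex e),
        proj s k (fend1 k (edge_vertex e)) == sgn &
        proj s k (fend2 k (edge_vertex e)) == sgn].
  rewrite inE; congr (_ && _).
    rewrite [in LHS]edge_vertexE; apply/imfsetP/idP => /=.
      move=> [x]; rewrite inE /= => xr e1.
      have -> : edge_vertex e = x by apply: val_inj; exact: (congr1 fst e1).
      by rewrite ffunE beE; move: xr; rewrite /xi_rule /diag_par; case: (k).
    move=> xr; exists (edge_vertex e) => //.
    rewrite inE /=; move: xr; rewrite ffunE beE /xi_rule /diag_par.
    by case: (k).
  rewrite edge_vertexE ends_diag; apply/forallP/andP => [h|[h1 h2] u].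
    split; [have := h (fend1 k (edge_vertex e))|have := h (fend2 k (edge_vertex e))];
      by rewrite !inE eqxx ?orbT.
  apply/implyP; rewrite !inE => /orP[]/eqP ue.
    by have -> : u = fend1 k (edge_vertex e) by apply: val_inj.
  by have -> : u = fend2 k (edge_vertex e) by apply: val_inj.
case: i => [u //|e|e] /=; rewrite sgnE [in RHS]ffunE.
  by rewrite !eqb_id.
by rewrite !eqbF_neg.
Qed.

Lemma signed_edges_range t xi i : @triplet_range Om R k i (signed_edges t xi i).
Proof.
case: i => [u|e|e] /=; first by case: ifP => _; [right|left].
  by case: (plus_part _ _ _); [right|left].
by case: (minus_part _ _ _); [right|left; rewrite oppr0].
Qed.

Lemma signed_edges_open (x : coupling Om k) i :
  signed_edges x.1 (open_edges x) i =
  match i with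
  | IV u => if x.1 u then 1 else -1
  | IEplus e => (plus_part x.1 x.2.1 (edge_vertex e))%:R
  | IEminus e => - (minus_part x.1 x.2.2 (edge_vertex e))%:R
  end.
Proof.
case: i => [//|e|e] /=; rewrite !ffunE.
  by case: (x.1 _); case: (x.1 _); rewrite ?andbF ?andbT ?orbF.
by case: (x.1 _); case: (x.1 _); rewrite ?andbF ?andbT ?orbF.
Qed.

(** When spins turn from minus to plus, edges with two plus ends are only gained
and edges with two minus ends are only lost, so the signed indicators grow. *)
Lemma signed_edges_le (x y : coupling Om k) :
    (forall u, x.1 u -> y.1 u) -> (forall e, x.2.1 e -> y.2.1 e) ->
    (forall e, y.2.2 e -> x.2.2 e) ->
  forall i, signed_edges x.1 (open_edges x) i <= signed_edges y.1 (open_edges y) i.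
Proof.
move=> le1 le2 le3 i; rewrite !signed_edges_open; case: i => [u|e|e] /=.
- have := le1 u; case: (x.1 u); first by move=> ->.
  by move=> _; case: ifP => _ //; rewrite (le_trans (@lerN10 R)).
- by rewrite ler_nat !ffunE; case: and3P => // -[/le2 -> /le1 -> /le1 ->].
- rewrite lerN2 ler_nat !ffunE; case: and3P => // -[/le3 -> h1 h2] /=.
  by rewrite (contra (le1 _) h1) (contra (le1 _) h2).
Qed.

Hypothesis ha : 0 < a <= c.
Hypothesis hb : 0 < b <= c.

Lemma edge_par01 e : 0 <= edge_par a b c e <= 1.
Proof.
move: ha hb => /andP[a0 ac] /andP[b0 bc].
have c0 : 0 < c by exact: lt_le_trans a0 ac.
rewrite /edge_par; case: ifP => _.
  by rewrite divr_ge0 ?(ltW a0) ?(ltW c0) //= ler_pdivrMr // mul1r.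
by rewrite divr_ge0 ?(ltW b0) ?(ltW c0) //= ler_pdivrMr // mul1r.
Qed.

(** All the measures of the theorem have this form: [C] collects the conditions
on the colour of the triplet, and [o] is the boundary condition on the other. *)
Lemma triplet_FKG_of_weight (o : option bool) (C : pred (spin Om k)) (K : R)
    (mu : config Om -> R) : 0 <= K ->
    (forall t t', C t -> C t' -> C (ffor t t') && C (ffand t t')) ->
    (forall s, mu s = K * (C (proj s k) && bc_spin o (proj s (~~ k)))%:R *
       ((consistent s)%:R * spin_weight a b c s)) ->
  triplet_FKG a b c Om mu k.
Proof.
move=> K0 Clat muE d T P S U law f g [_ fm] [_ gm].
pose p := diag_par a b c (Om := Om) k; pose q := diag_par a b c (Om := Om) (~~ k).
have p01 x : 0 <= p x <= 1 by exact: edge_par01.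
have q01 x : 0 <= q x <= 1 by exact: edge_par01.
pose B x : set R := if k then [set u | u <= p x]%classic else (~` [set u | u <= 1 - p x])%classic.
have mle r : measurable [set u : R | u <= r]%classic.
  have -> : [set u : R | u <= r]%classic = `]-oo, r]%classic.
    by apply/seteqP; split=> u /=; rewrite in_itv.
  exact: measurable_itv.
have mB x : measurable (B x).
  by rewrite /B; case: (k) => //; apply: measurableC.
have UB x : uniform_prob (@ltr01 R) (B x) = (p x)%:E.
  rewrite /B; case: (k); first exact: uniform_prob_le.
  rewrite -[in RHS](subKr 1 (p x)); apply: uniform_prob_setC => //.
  by apply: uniform_prob_le; have := p01 x; lra.
have tE t : @triplet Om R a b c k (S t) (fun x => U x t) =
    signed_edges (proj (S t) k) (xi_of_bits k (S t) [ffun x => `[< B x (U x t) >]]).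
  apply: tripletE => x; rewrite ffunE /B -/(p x).
  case: (k); first exact: asboolb.
  rewrite ltNge -[RHS]/(~~ (U x t <= 1 - p x)) -(asboolb (U x t <= 1 - p x)).
  exact: asbool_neg.
pose w (x : coupling Om k) := (C x.1)%:R * coupling_weight o p q x.
pose X (x : coupling Om k) := signed_edges x.1 (open_edges x).
pose K' := K / ncompat R k o ([ffun=> false] : {ffun Vint Om -> bool}).
have K'0 : 0 <= K' by rewrite divr_ge0 // /ncompat ler0n.
have EE (h : (tindex Om k -> R) -> R) :
    'E_P[fun t => h (@triplet Om R a b c k (S t) (fun x => U x t))]%E =
    (K' * \sum_x w x * h (X x))%:E.
  transitivity ('E_P[fun t => h (signed_edges (proj (S t) k)
      (xi_of_bits k (S t) [ffun x => `[< B x (U x t) >]]))]%E).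
    by congr ('E_P[_]%E); apply/funext => t; rewrite tE.
  rewrite (expectation_law law mB UB
    (fun s be => h (signed_edges (proj s k) (xi_of_bits k s be)))).
  by rewrite (sum_config_coupling muE (fun t xi => h (signed_edges t xi))).
(* the total mass, because P is a probability *)
have Z1 : K' * \sum_x w x = 1.
  have e1 : 'E_P[fun=> 1%R]%E = (K' * \sum_x w x * 1)%:E := EE (fun=> 1).
  have e2 : 'E_P[fun=> 1%R]%E = 1%:E := expectation_cst P 1.
  move: e1; rewrite e2 => -[->]; congr (_ * _).
  by apply: eq_bigr => x _; rewrite mulr1.
have key : (\sum_x w x * f (X x)) * (\sum_x w x * g (X x)) <=
    (\sum_x w x) * (\sum_x w x * (f (X x) * g (X x))).
  apply: (FKG_of_four_functions (@four_functions_coupling R Om k)).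
  - by move=> x; apply: mulr_ge0; [exact: ler0n|exact: coupling_weight_ge0].
  - move=> x y; rewrite /w mulrACA [leRHS]mulrACA.
    have cw0 z : 0 <= coupling_weight o p q z by exact: coupling_weight_ge0.
    have C0 z : 0 <= (C z.1)%:R :> R by exact: ler0n.
    apply: ler_pM; [exact: mulr_ge0|exact: mulr_ge0| |exact: coupling_weightM].
    rewrite -!natrM ler_nat !mulnb; case: (boolP (C x.1 && C y.1)) => // /andP[Cx Cy].
    by rewrite Clat.
  - move=> x y; apply: fm => i; try exact: signed_edges_range.
    by apply: signed_edges_le => u; rewrite /= ffunE; [move=> ->|move=> ->|case/andP].
  - move=> x y; apply: gm => i; try exact: signed_edges_range.
    by apply: signed_edges_le => u; rewrite /= ffunE;
      [move=> ->; rewrite orbT|move=> ->; rewrite orbT|case/andP].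
rewrite (EE f) (EE g) (EE (fun v => f v * g v)) -EFinM lee_fin mulrACA.
have ZK D : K' * D = K' * K' * ((\sum_x w x) * D) by rewrite mulrACA Z1 mul1r.
by rewrite [leRHS]ZK ler_wpM2l // mulr_ge0.
Qed.
End Triplet.

Theorem proposition4p9 (R : realType) (a b c : R) (Om : domain)
    (ha : 0 < a <= c) (hb : 0 < b <= c) :
  (forall (ob ow : option bool) (k : bool),
     triplet_FKG a b c Om (Spin_bc a b c ob ow) k) /\
  (forall (A : {set V Om true}) (tau : V Om true -> bool),
     triplet_FKG a b c Om (cond (Spin a b c) (restr_eq A tau)) true /\
     triplet_FKG a b c Om
       (cond (Spin_bc a b c None (Some true)) (restr_eq A tau)) true).
Proof.
have wt0 (s : config Om) : 0 <= spin_weight a b c s.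
  move: ha hb => /andP[a0 ac] /andP[b0 bc].
  have c0 : 0 <= c by exact: ltW (lt_le_trans a0 ac).
  by rewrite mulr_ge0 // exprn_ge0 // divr_ge0 // ltW.
pose Z : R := \sum_(s : config Om | consistent s) spin_weight a b c s.
have SpinE (s : config Om) : Spin a b c s = Z^-1 * ((consistent s)%:R * spin_weight a b c s).
  by rewrite /Spin [LHS]mulrC.
have Z0 : 0 <= Z^-1 by rewrite invr_ge0 sumr_ge0.
have Spin0 (s : config Om) : 0 <= Spin a b c s by rewrite SpinE; apply: mulr_ge0 => //; apply: mulr_ge0 => //; apply: ler0n.
have condE (mu : config Om -> R) (C : pred (config Om)) s :
    cond mu C s = (\sum_(s' : config Om | C s') mu s')^-1 * ((C s)%:R * mu s).
  by rewrite /cond [LHS]mulrC.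
have bc_lattice k o (t t' : spin Om k) : bc_spin o t -> bc_spin o t' ->
    bc_spin o (ffor t t') && bc_spin o (ffand t t').
  case: o => //= sgn /forallP h /forallP h'.
  apply/andP; split; apply/forallP => u; apply/implyP => ub; rewrite ffunE;
    by rewrite (eqP (implyP (h u) ub)) (eqP (implyP (h' u) ub)) ?orbb ?andbb.
have restr_lattice (A : {set V Om true}) tau (t t' : spin Om true) :
    [forall u in A, t u == tau u] -> [forall u in A, t' u == tau u] ->
    [forall u in A, ffor t t' u == tau u] && [forall u in A, ffand t t' u == tau u].
  move=> /forall_inP h /forall_inP h'; apply/andP.
  by split; apply/forall_inP => u uA; rewrite ffunE (eqP (h u uA)) (eqP (h' u uA))
    ?orbb ?andbb.
have Spin_bcE ob ow (s : config Om) : Spin_bc a b c ob ow s =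
    (\sum_(s' : config Om | bc true ob s' && bc false ow s') Spin a b c s')^-1 * Z^-1 *
    (bc_spin ob s.1 && bc_spin ow s.2)%:R * ((consistent s)%:R * spin_weight a b c s).
  by rewrite /Spin_bc condE SpinE /= [_%:R * (Z^-1 * _)]mulrCA !mulrA.
split=> [ob ow k|A tau].
  apply: (@triplet_FKG_of_weight R a b c Om k ha hb (if k then ow else ob)
    (@bc_spin Om k (if k then ob else ow))) => [|t t'|s].
  3: by rewrite Spin_bcE; congr (_ * _%:R * _); case: (k) => //; rewrite andbC.
  - by rewrite mulr_ge0 // invr_ge0 sumr_ge0.
  - exact: bc_lattice.
split.
  apply: (@triplet_FKG_of_weight R a b c Om true ha hb None
    (fun t => [forall u in A, t u == tau u])) => [|t t'|s].
  3: by rewrite condE SpinE andbT [_%:R * (Z^-1 * _)]mulrCA !mulrA.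
  - by rewrite mulr_ge0 // invr_ge0 sumr_ge0.
  - exact: restr_lattice.
pose S1 : R := \sum_(s : config Om | bc true None s && bc false (Some true) s) Spin a b c s.
pose S2 : R := \sum_(s : config Om | restr_eq A tau s) Spin_bc a b c None (Some true) s.
apply: (@triplet_FKG_of_weight R a b c Om true ha hb (Some true)
    (fun t => [forall u in A, t u == tau u]) (S2^-1 * (S1^-1 * Z^-1))) => [|t t'|s].
- rewrite mulr_ge0 ?invr_ge0 ?sumr_ge0 // => [s _|].
    rewrite /Spin_bc condE; apply: mulr_ge0; first by rewrite invr_ge0 sumr_ge0.
    by apply: mulr_ge0 => //; apply: ler0n.
  by rewrite mulr_ge0 // invr_ge0 sumr_ge0.
- exact: restr_lattice.
- rewrite condE Spin_bcE /= -/S1 -/S2 -[in RHS]mulnb natrM -/(restr_eq A tau s).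
  by ring.
Qed.
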